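(* Let $\delta\in[\frac12,1]$ and let $(u,v)$ satisfy the boundary conditions and the divergence-free condition of the context. There exists $\delta'$ such that for $q=1+\delta'$, $$\|u_\omega\|_{L^4_{*,0}}\lesssim\|u\|_X^{\frac12}\|u\|_{\dot H^2_{*,2+\delta}}^{\frac12}.$$ (The conclusion does not involve $q$.)
   Context: $R_0>0$, $\theta_0>0$ (small), $0<\varepsilon\le1$. $(\omega,R)\in\Omega=(0,\theta_0)\times(R_0,\infty)$; $r=r(R)=R_0+\sqrt\varepsilon(R-R_0)$; $\iint=\int_0^{\theta_0}\int_{R_0}^\infty\cdot\,dR\,d\omega$. Boundary conditions: $u=v=0$ on $\{\omega=0\}$ and on $\{R=R_0\}$; $\varepsilon v_\omega+ru_R=0$ on $\{\omega=\theta_0\}$ (and, for the associated pressure $P$, $Pr=2\varepsilon u_\omega$ there). Divergence-free condition: $u_\omega+\partial_R(rv)=0$. Norms: $\|h\|_{L^4_{*,0}}=(\iint|h|^4)^{1/4}$; $\|u\|_X^2=\iint(u^2r^\delta+u_\omega^2r^\delta+u_R^2r^{1+\delta})$; $\|u\|_{\dot H^2_{*,2+\delta}}^2=\iint\big(\frac{u_{\omega\omega}^2}{r^4}+\frac{u_{\omega R}^2}{r^2}+u_{RR}^2\big)r^{2+\delta}$. The norms on the right-hand side are assumed finite; the implicit constant is independent of $\varepsilon$ and $(u,v)$. *)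

(* Defs.v *)
From mathcomp Require Import all_boot all_order all_algebra.
From mathcomp Require Import all_classical all_reals all_analysis.

Set Implicit Arguments.
Unset Strict Implicit.
Unset Printing Implicit Defensive.

Import Order.TTheory GRing.Theory Num.Theory.
Import numFieldNormedType.Exports.

Local Open Scope classical_set_scope.
Local Open Scope ring_scope.

(* Points are pairs z with z.1 = omega (angle) and z.2 = R (scaled radius).
   Functions on the domain are functions on the whole plane, of which only the
   restriction to [Omega] matters. *)

Definition Omega {R : realType} (R0 theta0 : R) : set (R * R) :=
  [set z | 0 < z.1 < theta0 /\ R0 < z.2].

Definition rscaled {R : realType} (R0 eps : R) (z : R * R) : R :=
  R0 + Num.sqrt eps * (z.2 - R0).

Notation leb2 R := (@lebesgue_measure R \x @lebesgue_measure R)%E (only parsing).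

(* Test functions: C^oo on the plane, with compact support contained in U. *)

Definition d_omega {R : realType} (phi : R * R -> R) (z : R * R) : R :=
  derive1 (fun s : R => phi (s, z.2)) z.1.

Definition d_R {R : realType} (phi : R * R -> R) (z : R * R) : R :=
  derive1 (fun s : R => phi (z.1, s)) z.2.

Fixpoint Ck {R : realType} (n : nat) (phi : R * R -> R) : Prop :=
  continuous phi /\
  if n is m.+1 then
    [/\ forall z : R * R, derivable (fun s : R => phi (s, z.2)) z.1 1,
        forall z : R * R, derivable (fun s : R => phi (z.1, s)) z.2 1,
        Ck m (d_omega phi) & Ck m (d_R phi)]
  else True.

Definition test_function {R : realType} (U : set (R * R)) (phi : R * R -> R) :=
  [/\ forall n : nat, Ck n phi,
      compact (closure [set z | phi z != 0]) &
      closure [set z | phi z != 0] `<=` U].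

(* Integrability on bounded subsets of Omega, i.e. locally up to the boundary,
   so that boundary values in the sense of traces make sense. *)
Definition loc_integrable {R : realType} (R0 theta0 : R) (f : R * R -> R) :=
  forall M : R, (leb2 R).-integrable
    (Omega R0 theta0 `&` [set z | z.2 < M]) (EFin \o f).

(* When U = Omega, g is the weak partial derivative of f.  When U is an open
   set containing Omega, test functions need not vanish on the part of the
   boundary of Omega lying in U, and the absence of a boundary term in the
   integration by parts says moreover that the trace of f is zero there. *)

Definition weak_d_omega {R : realType} (R0 theta0 : R) (U : set (R * R))
    (f g : R * R -> R) : Prop :=
  [/\ loc_integrable R0 theta0 f, loc_integrable R0 theta0 g &
      forall phi : R * R -> R, test_function U phi ->
        (\int[leb2 R]_(z in Omega R0 theta0) (f z * d_omega phi z)%:E =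
         - \int[leb2 R]_(z in Omega R0 theta0) (g z * phi z)%:E)%E].

Definition weak_d_R {R : realType} (R0 theta0 : R) (U : set (R * R))
    (f g : R * R -> R) : Prop :=
  [/\ loc_integrable R0 theta0 f, loc_integrable R0 theta0 g &
      forall phi : R * R -> R, test_function U phi ->
        (\int[leb2 R]_(z in Omega R0 theta0) (f z * d_R phi z)%:E =
         - \int[leb2 R]_(z in Omega R0 theta0) (g z * phi z)%:E)%E].

Definition zero_at_omega0 {R : realType} (R0 theta0 : R) (f : R * R -> R) :=
  exists g : R * R -> R,
    weak_d_omega R0 theta0 [set z | z.1 < theta0 /\ R0 < z.2] f g.

Definition zero_at_theta0 {R : realType} (R0 theta0 : R) (f : R * R -> R) :=
  exists g : R * R -> R,
    weak_d_omega R0 theta0 [set z | 0 < z.1 /\ R0 < z.2] f g.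

Definition zero_at_R0 {R : realType} (R0 theta0 : R) (f : R * R -> R) :=
  exists g : R * R -> R,
    weak_d_R R0 theta0 [set z | 0 < z.1 < theta0] f g.

Definition boundary_conditions {R : realType} (R0 theta0 eps : R)
    (u v uR vw : R * R -> R) : Prop :=
  [/\ zero_at_omega0 R0 theta0 u /\ zero_at_omega0 R0 theta0 v,
      zero_at_R0 R0 theta0 u /\ zero_at_R0 R0 theta0 v &
      zero_at_theta0 R0 theta0 (fun z => eps * vw z + rscaled R0 eps z * uR z)].

(* The norms take the (weak) derivatives of u as arguments: uw = u_omega,
   uww = u_omega,omega, uwR = u_omega,R, and so on. *)

Definition norm_L4 {R : realType} (R0 theta0 : R) (h : R * R -> R) : \bar R :=
  ((\int[leb2 R]_(z in Omega R0 theta0) (`|h z| ^+ 4)%:E) `^ 4^-1)%E.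

Definition norm_X {R : realType} (R0 theta0 eps delta : R)
    (u uw uR : R * R -> R) : \bar R :=
  ((\int[leb2 R]_(z in Omega R0 theta0)
     (u z ^+ 2 * rscaled R0 eps z `^ delta + uw z ^+ 2 * rscaled R0 eps z `^ delta
      + uR z ^+ 2 * rscaled R0 eps z `^ (1 + delta))%:E) `^ 2^-1)%E.

Definition norm_H2 {R : realType} (R0 theta0 eps delta : R)
    (uww uwR uRR : R * R -> R) : \bar R :=
  ((\int[leb2 R]_(z in Omega R0 theta0)
     ((uww z ^+ 2 / rscaled R0 eps z ^+ 4 + uwR z ^+ 2 / rscaled R0 eps z ^+ 2
       + uRR z ^+ 2) * rscaled R0 eps z `^ (2 + delta))%:E) `^ 2^-1)%E.

(* Main.v *)
(* Write f for u_omega. Since r v has R-derivative - f and v vanishes on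
   {omega = 0}, f vanishes there as well; it also decays as R tends to infinity,
   being square integrable. Hence, on almost every line,
   f^2 <= 2 int |f f_omega| d omega   and   r^(1 - delta) f^2 <= 2 int r^(1 - delta) |f f_R| dR,
   the second bound using that r^(1 - delta) is nondecreasing. Multiplying the two and
   integrating gives, as in Ladyzhenskaya's inequality,
   iint f^4 <= 4 (iint r^(delta - 1) |f f_omega|) (iint r^(1 - delta) |f f_R|).
   The Cauchy-Schwarz inequality concludes: r^(delta - 1) = r^(delta/2) r^((delta - 2)/2)
   matches the weights exactly, and r^(1 - delta) <= R0^(1 - 2 delta) r^delta because
   delta >= 1/2. *)

Require Import Defs.
From mathcomp Require Import all_boot all_order all_algebra.
From mathcomp Require Import all_classical all_reals all_analysis.
From mathcomp Require Import measurable_realfun ring lra.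
Set Implicit Arguments.
Unset Strict Implicit.
Unset Printing Implicit Defensive.
Import Order.TTheory GRing.Theory Num.Theory.
Import numFieldNormedType.Exports.
Local Open Scope classical_set_scope.
Local Open Scope ring_scope.

(** * Smooth functions of one variable *)

(** Since the derivatives are only weak, the fundamental theorem of calculus along lines has to be
    established first. The weak equations are tested on products of a function of omega and a
    function of R; freeing one variable gives, on almost every line, an equation in the other. The
    exceptional lines depend on the test function, so a countable family of tests must suffice: they
    are built from [bumpn] with rational endpoints, whose limits are indicators of intervals. On
    each good line, the du Bois-Reymond argument writes f as a constant plus a Lebesgue primitive.

    No boundary value is ever evaluated. That f vanishes at omega = 0 means that its extension by
    zero to omega > -1 still has a weak omega-derivative, and a point of ]-1, 0[ fixes the constant
    of the primitive. Likewise no limit at infinity is taken: a violation of the second bound at one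
    point would propagate to all larger R and make a finite weighted integral of f^2 infinite.

    The constant is [(4 * R0]^ (1 - 2 * delta)) [^ 4^-1]; eps enters only through the radius, which
    is at least [R0] for every eps. *)

Section smooth.
Context {R : realType}.
Implicit Types (f g a b : R -> R) (x p q : R).

Fixpoint diffn (n : nat) f : Prop :=
  if n is m.+1 then (forall x, derivable f x 1) /\ diffn m (derive1 f) else True.

Definition smooth f := forall n, diffn n f.

Lemma diffnS n f g : (forall x, is_derive x (1:R) f (g x)) -> diffn n g -> diffn n.+1 f.
Proof.
move=> fg gn; split=> [x|]; first by have [] := fg x.
suff -> : derive1 f = g by [].
by apply/funext => x; rewrite derive1E; have [_] := fg x.
Qed.

Lemma diffn_is_derive n f : diffn n.+1 f -> forall x, is_derive x (1:R) f (derive1 f x).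
Proof. by move=> [df _] x; split => //; rewrite derive1E. Qed.

Lemma diffnW n f : diffn n.+1 f -> diffn n f.
Proof.
elim: n f => [//|n IH] f [df fn]; split => //; exact: IH.
Qed.

Lemma diffn_cst n (c : R) : diffn n (fun=> c).
Proof.
elim: n c => [//|n IH] c; apply: (@diffnS _ _ (fun=> 0)) (IH 0) => x.
Qed.

Lemma diffnD n f g : diffn n f -> diffn n g -> diffn n (fun x => f x + g x).
Proof.
elim: n f g => [//|n IH] f g fn gn.
apply: (@diffnS _ _ (fun x => derive1 f x + derive1 g x)); last first.
  by apply: IH; [case: fn|case: gn].
move=> x; have Df := diffn_is_derive fn x; have Dg := diffn_is_derive gn x.
exact: is_deriveD.
Qed.

Lemma diffnM n f g : diffn n f -> diffn n g -> diffn n (fun x => f x * g x).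
Proof.
elim: n f g => [//|n IH] f g fn gn.
apply: (@diffnS _ _ (fun x => f x * derive1 g x + g x * derive1 f x)).
  move=> x; have Df := diffn_is_derive fn x; have Dg := diffn_is_derive gn x.
  by apply: is_derive_eq (is_deriveM _ _) _; rewrite /GRing.scale/=.
apply: diffnD; apply: IH.
- exact: diffnW.
- by case: gn.
- exact: diffnW.
- by case: fn.
Qed.

Lemma diffn_id n : diffn n (@id R).
Proof.
case: n => // n; apply: (@diffnS _ _ (fun=> 1)) (diffn_cst n 1) => x.
Qed.

Lemma diffn_affine n (k c : R) f : diffn n f -> diffn n (fun x => f (k * x + c)).
Proof.
elim: n f => [//|n IH] f fn.
apply: (@diffnS _ _ (fun x => k * derive1 f (k * x + c))); last first.
  by apply: diffnM; [exact: diffn_cst|apply: IH; case: fn].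
move=> x; have Df := diffn_is_derive fn (k * x + c).
have Dg : is_derive x (1:R) (fun x => k * x + c) k.
  by apply: is_derive_eq; rewrite addr0 scaler1.
by rewrite mulrC; exact: (@is_derive1_comp _ f (fun x => k * x + c)).
Qed.

(* The class of the functions x |-> P(1/x) exp(-1/x), extended by 0, is stable
   under differentiation: P becomes X^2 (P - P'). *)
Definition flat (P : {poly R}) x : R :=
  if 0 < x then P.[x^-1] * expR (- x^-1) else 0.

(** The exponential dominates each term of its series, so y^i exp(-y) <= i!; summing over the
    coefficients gives the constant. *)
Lemma expRN_poly_bound (P : {poly R}) :
  exists C : R, forall y, 0 < y -> `|P.[y] * expR (- y)| <= C.
Proof.
exists (\sum_(i < size P) `|P`_i| * i`!%:R) => y y0.
rewrite horner_coef mulr_suml (le_trans (ler_norm_sum _ _ _))//.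
apply: ler_sum => -[[|i] /= _] _.
  rewrite expr0 mulr1 normrM ler_wpM2l// ger0_norm ?expR_ge0//.
  by rewrite expR_le1 oppr_le0 ltW.
rewrite -mulrA normrM ler_wpM2l// ger0_norm; last first.
  by rewrite mulr_ge0 ?expR_ge0// exprn_ge0// ltW.
rewrite expRN ler_pdivrMr ?expR_gt0// mulrC -ler_pdivrMr ?ltr0n ?fact_gt0//.
by rewrite (le_trans _ (expR_ge1Dxn i (ltW y0)))// lerDr.
Qed.

Lemma is_derive_flat P x :
  is_derive x (1:R) (flat P) (flat ('X^2 * (P - P^`())) x).
Proof.
have [x0|x0|->] := ltgtP x 0.
- have -> : flat ('X^2 * (P - P^`())) x = 0 by rewrite /flat ltNge (ltW x0).
  apply: (@near_eq_is_derive _ _ _ (fun=> 0)).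
  near=> y; rewrite /flat ltNge; case: leP => // y0.
  suff : y < 0 by rewrite ltNge (ltW y0).
  by near: y; exact: lt_nbhsl.
- pose g y : R := P.[y^-1] * expR (- y^-1).
  apply: (@near_eq_is_derive _ _ _ g).
    near=> y; rewrite /flat ifT//; near: y; exact: lt_nbhsr.
  have xN : x != 0 by rewrite gt_eqF.
  have DV : is_derive x (1:R) (fun y : R => y^-1) (- x ^- 2).
    by apply: is_derive_eq (is_deriveV xN (is_derive_id x (1:R))) _; rewrite scaler1.
  have DP := @is_derive1_comp _ _ _ _ _ _ (is_derive_poly P (x^-1)) DV.
  have DE := @is_derive1_comp _ expR (fun y : R => - y^-1) _ _ _
    (is_derive_expR (- x^-1)) (is_deriveN DV).
  apply: is_derive_eq (is_deriveM DP DE) _.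
  rewrite /flat x0 /= !hornerE /GRing.scale/=.
  by field.
- have -> : flat ('X^2 * (P - P^`())) 0 = 0 by rewrite /flat ltxx.
  suff h : (fun h => h^-1 *: ((flat P \o shift 0) (h *: (1:R)) - flat P 0)) @ 0^' --> (0:R).
    split; first by apply/cvg_ex; exists 0.
    exact: cvg_lim.
  (* The difference quotient P(1/h) exp(-1/h) / h equals h times (X^2 P)(1/h) exp(-1/h), hence is at
     most C |h|: one power of 1/h is the quotient itself, the other pays for the factor h. *)
  have [C hC] := expRN_poly_bound ('X^2 * P).
  apply: (@cvg_to_0_linear _ _ C 1) => // h /andP[hN _].
  have {}hN : h != 0 by rewrite -normr_gt0.
  rewrite /= addr0 /GRing.scale/= mulr1 {2}/flat ltxx subr0 /flat.
  have C0 : 0 <= C by rewrite (le_trans _ (hC 1 ltr01)).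
  case: ltP => h0; last by rewrite mulr0 normr0 mulr_ge0.
  rewrite (_ : h^-1 * _ = ('X^2 * P).[h^-1] * expR (- h^-1) * h); last first.
    by rewrite hornerM hornerXn; field.
  by rewrite normrM ler_wpM2r// hC// invr_gt0.
Unshelve. all: by end_near. Qed.

Lemma diffn_flat n P : diffn n (flat P).
Proof. by elim: n P => [//|n IH] P; exact: diffnS (@is_derive_flat P) (IH _). Qed.

Definition hat p q x : R := flat 1 (x - p) * flat 1 (q - x).

Lemma flat1_itv x : 0 <= flat 1 x < 1.
Proof.
rewrite /flat; case: ifP => [x0|_]; last by rewrite lexx ltr01.
by rewrite hornerE mul1r expR_ge0 expR_lt1 oppr_lt0 invr_gt0.
Qed.

Lemma flat1_gt0 x : 0 < x -> 0 < flat 1 x.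
Proof. by move=> x0; rewrite /flat x0 hornerE mul1r expR_gt0. Qed.

Lemma flat_le0 P x : x <= 0 -> flat P x = 0.
Proof. by rewrite /flat ltNge => ->. Qed.

Lemma smooth_hat p q : smooth (hat p q).
Proof.
move=> n; apply: diffnM.
- rewrite (_ : (fun _ => _) = fun x => flat 1 (1 * x + - p)); last first.
    by apply/funext => x; rewrite mul1r.
  exact/diffn_affine/diffn_flat.
- rewrite (_ : (fun _ => _) = fun x => flat 1 (- 1 * x + q)); last first.
    by apply/funext => x; rewrite mulN1r addrC.
  exact/diffn_affine/diffn_flat.
Qed.

Lemma hat_itv p q x : 0 <= hat p q x < 1.
Proof.
have /andP[u0 u1] := flat1_itv (x - p).
have /andP[v0 v1] := flat1_itv (q - x).
by rewrite mulr_ge0//= mulr_ilt1.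
Qed.

Lemma hat_gt0 p q x : p < x < q -> 0 < hat p q x.
Proof. by move=> /andP[px xq]; rewrite mulr_gt0// flat1_gt0// subr_gt0. Qed.

Lemma hat_out p q x : ~~ (p < x < q) -> hat p q x = 0.
Proof.
rewrite negb_and -!leNgt => /orP[xp|qx]; rewrite /hat.
- by rewrite (@flat_le0 _ (x - p)) ?mul0r// subr_le0.
- by rewrite (@flat_le0 _ (q - x)) ?mulr0// subr_le0.
Qed.

(* Converges to the indicator function of ]p, q[ as n tends to infinity, without
   any mollification. *)
Definition bumpn p q (n : nat) x : R := 1 - (1 - hat p q x) ^+ n.

Lemma smooth_exp f n : smooth f -> smooth (fun x => f x ^+ n).
Proof.
move=> sf m; elim: n => [|n IH]; first by under eq_fun do rewrite expr0; exact: diffn_cst.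
by under eq_fun do rewrite exprS; exact: diffnM.
Qed.

Lemma smooth_opp f : smooth f -> smooth (fun x => - f x).
Proof.
by move=> sf n; under eq_fun do rewrite -mulN1r; apply: diffnM => //; exact: diffn_cst.
Qed.

Lemma smooth_bumpn p q n : smooth (bumpn p q n).
Proof.
move=> m; apply: diffnD; first exact: diffn_cst.
apply: smooth_opp; apply: smooth_exp => k; apply: diffnD; first exact: diffn_cst.
exact/smooth_opp/smooth_hat.
Qed.

Lemma bumpn_itv p q n x : 0 <= bumpn p q n x <= 1.
Proof.
have /andP[b0 b1] := hat_itv p q x.
rewrite subr_ge0 lerBlDr lerDl exprn_ge0 ?subr_ge0 ?(ltW b1)// andbT.
by rewrite exprn_ile1// ?subr_ge0 ?(ltW b1)// lerBlDr lerDl.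
Qed.

Lemma bumpn_out p q n x : ~~ (p < x < q) -> bumpn p q n x = 0.
Proof. by move=> h; rewrite /bumpn hat_out// subr0 expr1n subrr. Qed.

(** Inside the interval the powers of [1 - hat p q x], a number in [0, 1[, tend to 0; outside, every
    term is exactly 0. *)
Lemma cvg_bumpn p q x : bumpn p q n x @[n --> \oo] --> (\1_(`]p, q[) x : R).
Proof.
have [h|h] := boolP (p < x < q).
  rewrite indicE mem_set/= ?in_itv//= -[X in _ --> X]subr0.
  apply: cvgB; first exact: cvg_cst.
  apply: cvg_expr; have /andP[b0 b1] := hat_itv p q x.
  by rewrite ger0_norm ?subr_ge0 ?(ltW b1)// ltrBlDr ltrDl hat_gt0.
under eq_fun do rewrite bumpn_out//.
rewrite indicE memNset/= ?in_itv//=; last exact/negP.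
exact: cvg_cst.
Qed.

End smooth.

(** * Primitives of integrable functions *)

Section primitive.
Context {R : realType}.
Implicit Types (f g a b : R -> R) (x p q : R).
Notation mu := (@lebesgue_measure R).

Definition vanishes_outside p q f := forall x, ~~ (p <= x <= q) -> f x = 0.

Lemma smooth_derive1 f : smooth f -> smooth (derive1 f).
Proof. by move=> sf n; have [] := sf n.+1. Qed.

Lemma smooth_derivable f x : smooth f -> derivable f x 1.
Proof. by move=> sf; have [+ _] := sf 1%N; exact. Qed.

Lemma smooth_continuous f : smooth f -> continuous f.
Proof.
move=> sf x; apply: differentiable_continuous.
exact/derivable1_diffP/smooth_derivable.
Qed.

Lemma smooth_measurable f : smooth f -> measurable_fun setT f.
Proof. by move=> /smooth_continuous; exact: continuous_measurable_fun. Qed.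

Lemma smooth_bounded p q f : smooth f -> vanishes_outside p q f ->
  exists C : R, forall x, `|f x| <= C.
Proof.
move=> sf fpq.
have [M [_ HM]] : bounded_set (f @` `[p, q]).
  apply: compact_bounded; apply: continuous_compact; last exact: segment_compact.
  exact/continuous_subspaceT/smooth_continuous.
exists (Num.max 0 (M + 1)) => x.
have [xpq|xpq] := boolP (p <= x <= q); last by rewrite fpq// normr0 le_max lexx.
by rewrite le_max orbC HM// ?ltrDl//; exists x.
Qed.

Lemma integrable_outside p q f : mu.-integrable `[p, q] (EFin \o f) ->
  vanishes_outside p q f -> mu.-integrable setT (EFin \o f).
Proof.
move=> fi fpq; suff -> : EFin \o f = (EFin \o f) \_ `[p, q] by rewrite -integrable_mkcond.
apply/funext => x; rewrite patchE; case: ifPn => //.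
by rewrite notin_setE/= in_itv/= => /negP h; rewrite /= fpq.
Qed.

Lemma smooth_integrable p q f : smooth f -> vanishes_outside p q f ->
  mu.-integrable setT (EFin \o f).
Proof.
move=> sf; apply: integrable_outside.
apply: continuous_compact_integrable; first exact: segment_compact.
exact/continuous_subspaceT/smooth_continuous.
Qed.

Lemma vanishes_outside_derive1 p q f : vanishes_outside p q f ->
  vanishes_outside p q (derive1 f).
Proof.
move=> fpq x; rewrite negb_and -!ltNge => h.
rewrite derive1E (@near_eq_derive _ _ _ f (fun=> 0)); last first.
  case/orP: h => h; near=> y; apply: fpq; rewrite negb_and -!ltNge; apply/orP.
    by left; near: y; exact: lt_nbhsl.
  by right; near: y; exact: lt_nbhsr.
exact: derive_cst.
Unshelve. all: by end_near. Qed.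

Definition prim g x : R := \int[mu]_(t in `]-oo, x]) g t.

Lemma is_derive_prim g x : mu.-integrable setT (EFin \o g) ->
  {for x, continuous g} -> is_derive x (1:R) (prim g) (g x).
Proof.
move=> gi gx.
have [|||h1 h2] := @continuous_FTC1 _ g -oo%O x (x + 1) _ _ _ gx.
- by rewrite ltrDl.
- exact: integrableS gi.
- by rewrite ltNyr.
- by split; [exact: h1|rewrite -derive1E; exact: h2].
Qed.

Lemma smooth_prim g : mu.-integrable setT (EFin \o g) -> smooth g -> smooth (prim g).
Proof.
move=> gi sg [//|n]; apply: (@diffnS _ _ _ g) => // x.
exact/is_derive_prim/smooth_continuous.
Qed.

(** To the right of [q] the primitive is the full integral of [g]; the zero mean is what makes the
    support compact. *)
Lemma prim_outside p q g : mu.-integrable setT (EFin \o g) ->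
  vanishes_outside p q g -> \int[mu]_t g t = 0 ->
  vanishes_outside p q (prim g).
Proof.
move=> gi gpq g0 x; rewrite negb_and -!ltNge => /orP[xp|qx].
  rewrite /prim /Rintegral integral0_eq//= => t; rewrite in_itv/= => tx.
  by rewrite gpq// negb_and -ltNge (le_lt_trans tx xp).
rewrite -g0 /prim [LHS]Rintegral_mkcond; apply: eq_Rintegral => t _.
rewrite patchE; case: ifPn => //; rewrite notin_setE/= in_itv/= => /negP.
by rewrite -ltNge => xt; rewrite gpq// negb_and -!ltNge (lt_trans qx xt) orbT.
Qed.

End primitive.

(** * Bounded multipliers and dominated convergence *)

Section measure_lemmas.
Context d (T : measurableType d) (R : realType) (mu : {measure set T -> \bar R}).
Implicit Types (D : set T) (f g : T -> R).

Lemma integrable_mul_bounded D f g (C : R) : measurable D ->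
  mu.-integrable D (EFin \o f) -> measurable_fun D g ->
  (forall x, D x -> `|g x| <= C) ->
  mu.-integrable D (EFin \o (fun x => f x * g x)).
Proof.
move=> mD fi mg gC.
have -> : EFin \o (fun x => f x * g x) = ((EFin \o g) \* (EFin \o f))%E.
  by apply/funext => x /=; rewrite mulrC EFinM.
apply: integrableMr => //.
exists C; split; first exact: num_real.
by move=> M CM x Dx /=; exact: le_trans (gC x Dx) (ltW CM).
Qed.

Lemma Rintegral_cvg0 (f_ : nat -> T -> R) f g :
  (forall n, measurable_fun setT (f_ n)) ->
  measurable_fun setT f ->
  mu.-integrable setT (EFin \o g) ->
  (forall n x, `|f_ n x| <= g x) ->
  (forall x, f_ n x @[n --> \oo] --> f x) ->
  (forall n, \int[mu]_x f_ n x = 0) -> \int[mu]_x f x = 0.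
Proof.
move=> mf_ mf gi f_g f_f f0.
have [] := @dominated_convergence _ _ _ mu setT measurableT (fun n => EFin \o f_ n)
  (EFin \o f) (EFin \o g) _ _ _ gi.
- by move=> n; exact/measurable_EFinP.
- exact/measurable_EFinP.
- by apply: aeW => x _; apply/fine_cvgP; split; [exact: nearW|exact: f_f].
- by apply: aeW => x n _; rewrite /= lee_fin.
move=> fi _ h; rewrite /Rintegral.
have fni n : mu.-integrable setT (EFin \o f_ n).
  by apply: le_integrable gi => //;
    [exact/measurable_EFinP|move=> x _; rewrite /= lee_fin (le_trans (f_g n x))// ler_norm].
have : (fun n => \int[mu]_x (EFin \o f_ n) x)%E @ \oo --> 0%E.
  rewrite (_ : (fun _ => _) = cst 0%E); first exact: cvg_cst.
  apply/funext => n; rewrite -[LHS]fineK ?integrable_fin_num//.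
  by congr EFin; exact: f0.
by move/(cvg_unique _ h) => ->.
Qed.

End measure_lemmas.

(** * The fundamental lemma of the calculus of variations, with countably many tests *)

Section du_bois_reymond.
Context {R : realType}.
Implicit Types (f g k a b : R -> R) (x : R).
Notation mu := (@lebesgue_measure R).

Lemma prim_Rintegral_itv g x y : mu.-integrable setT (EFin \o g) -> x <= y ->
  prim g y - prim g x = \int[mu]_(t in `]x, y]) g t.
Proof.
move=> gi xy; rewrite /prim Rintegral_itvB//.
exact: integrableS gi.
Qed.

(** As n grows the hypothesis says that [k] has integral 0 over every interval with rational
    endpoints inside ]al, be[, so [prim k] is constant on the rationals there. By Lebesgue's
    differentiation theorem, [k] is almost everywhere the derivative of [prim k], which can only be
    0. Restricting to rational endpoints keeps the family of tests countable, as the passage to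
    slices requires. *)
Lemma ae0_of_bumpn k (al be : R) : mu.-integrable setT (EFin \o k) ->
  (forall (p q : rat) n, al < ratr p -> ratr q < be ->
     \int[mu]_t (k t * bumpn (ratr p) (ratr q) n t) = 0) ->
  {ae mu, forall x, al < x < be -> k x = 0}.
Proof.
move=> ki k0.
have mk : measurable_fun setT k by apply/measurable_EFinP; exact: measurable_int ki.
have itv0 (p q : rat) : al < ratr p -> ratr q < be -> ratr p <= (ratr q : R) ->
    prim k (ratr q) = prim k (ratr p).
  move=> alp qbe pq; apply/eqP; rewrite -subr_eq0 prim_Rintegral_itv//.
  rewrite -Rintegral_itv_bndo_bndc//; last exact: integrableS ki.
  rewrite Rintegral_mkcond; apply/eqP.
  rewrite (_ : (fun x => _) = fun x => k x * \1_(`]ratr p, ratr q[) x); last first.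
    apply/funext => x; rewrite patchE indicE.
    by case: ifP => _; rewrite ?mulr1 ?mulr0.
  apply: (@Rintegral_cvg0 _ _ _ mu (fun n t => k t * bumpn (ratr p) (ratr q) n t)
    (fun x => k x * \1_(`]ratr p, ratr q[) x) (fun t => `|k t|)).
  - by move=> n; apply: measurable_funM => //; apply: smooth_measurable; exact: smooth_bumpn.
  - exact: measurable_funM.
  - exact: (integrable_norm ki).
  - move=> n x; rewrite normrM ler_piMr//.
    by have /andP[b0 b1] := bumpn_itv (ratr p) (ratr q) n x; rewrite ger0_norm.
  - by move=> x; apply: cvgM; [exact: cvg_cst|exact: cvg_bumpn].
  - by move=> n; exact: k0.
(* Lebesgue differentiation: at almost every x, [prim k] is differentiable with derivative [k x]. *)
have /FTC1Ny H := fun y : R => @integrableS _ _ _ mu setT `]-oo, y] (EFin \o k)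
  measurableT (measurable_itv _) (@subsetT _ _) ki.
have locf : locally_integrable setT k by apply: open_integrable_locally => //; exact: openT.
have {H} := H locf.
apply: filterS; first exact: (ae_filter_ringOfSetsType mu).
move=> x [dF F'] /andP[alx xbe].
have near_rat (P : set R) : (\forall y \near x, P y) ->
    exists2 r : rat, x < ratr r < be & P (ratr r).
  move=> /nbhs_ballP[e /= e0 eP].
  have : x < Num.min be (x + e) by rewrite lt_min xbe ltrDl.
  move=> /rat_in_itvoo[r]; rewrite in_itv/= lt_min => /and3P[xr rbe rxe].
  exists r; first by rewrite xr.
  by apply: eP; rewrite /ball/= distrC gtr0_norm ?subr_gt0// ltrBlDl.
have const (p q : rat) : x < ratr p < be -> x < ratr q < be ->
    prim k (ratr q) = prim k (ratr p).
  move=> /andP[xp pbe] /andP[xq qbe].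
  have [pq|/ltW qp] := leP (ratr p) (ratr q : R).
    by apply: itv0 => //; exact: lt_trans xp.
  by apply/esym/itv0 => //; exact: lt_trans xq.
(* Differentiability at x gives continuity there, which carries the constant value from the
   rationals on the right of x to x itself. *)
have cF : {for x, continuous (prim k)}.
  exact/differentiable_continuous/derivable1_diffP.
have Fx r : x < ratr r < be -> prim k x = prim k (ratr r).
  move=> xr; apply/eqP; apply: contrapT => /negP Fxr.
  have /near_rat[r' xr'] : \forall y \near x, prim k y != prim k (ratr r).
    near=> y; rewrite -subr_eq0; near: y.
    apply: (@cvgr_neq0 _ _ _ _ _ _ (prim k x - prim k (ratr r))); last by rewrite subr_eq0.
    by apply: cvgB; [exact: cF|exact: cvg_cst].
  by rewrite (const r r')// eqxx.
(* A nonzero derivative would make the difference quotient nonzero at all nearby points, whereas it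
   vanishes at the rational ones on the right. *)
rewrite -F' derive1E; apply/eqP; apply: contrapT => /negP DN.
have : \forall h \near 0^', h^-1 *: (prim k (h + x) - prim k x) != 0.
  have /cvgr_neq0 := dF; move=> /(_ DN); apply: filterS => h.
  by rewrite /= /GRing.scale/= mulr1.
move=> /nbhs_ballP[e /= e0 eP].
have [r] : exists2 r : rat, x < ratr r < be & `|x - ratr r| < e.
  apply: (near_rat (fun y => `|x - y| < e)).
  by apply/nbhs_ballP; exists e.
move=> xr xre; have /andP[xr' _] := xr.
have : (ratr r - x)^-1 *: (prim k (ratr r - x + x) - prim k x) != 0.
  apply: eP; last by rewrite subr_eq0 gt_eqF.
  by rewrite /ball/= sub0r opprB.
by rewrite subrK (Fx r)// subrr scaler0 eqxx.
Unshelve. all: by end_near. Qed.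

End du_bois_reymond.

(** * Fubini's theorem for real-valued integrals *)

Section Rintegral_fubini.
Context d1 d2 (T1 : measurableType d1) (T2 : measurableType d2) (R : realType).
Variables (m1 : {sigma_finite_measure set T1 -> \bar R})
  (m2 : {sigma_finite_measure set T2 -> \bar R}).
Variable f : T1 * T2 -> R.
Hypothesis fi : (m1 \x m2)%E.-integrable setT (EFin \o f).

Let F x := (\int[m2]_y (f (x, y))%:E)%E.
Let G y := (\int[m1]_x (f (x, y))%:E)%E.

Let Fi : m1.-integrable setT F.
Proof. exact: (integrable_fubini_F fi). Qed.

Let Gi : m2.-integrable setT G.
Proof.
have mf : measurable_fun setT (EFin \o f) by exact: measurable_int fi.
apply/integrableP; split; first exact: (measurable_fubini_G fi).
apply: le_lt_trans ((integrable21ltyP m1 m2 mf).1 fi).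
apply: ge0_le_integral => //.
- by apply: measurableT_comp => //; exact: (measurable_fubini_G fi).
- apply: (measurable_fun_fubini_tonelli_G (abse \o (EFin \o f))) => //.
    exact: measurableT_comp.
  by move=> z; exact: abse_ge0.
- move=> y _; apply: le_abse_integral => //.
  exact: (measurableT_comp mf (pair2_measurable y)).
Qed.

Lemma ae_eq_fine d (T : measurableType d) (m : {measure set T -> \bar R})
  (k : T -> \bar R) : m.-integrable setT k -> ae_eq m setT k (EFin \o (fine \o k)).
Proof.
move=> ki; have := integrable_ae measurableT ki; apply: filterS => x /= h _.
by rewrite fineK// h.
Qed.

(** An inner integral may be infinite on a null set of lines; [fine] sends such values to 0, so
    absolute values only decrease. *)
Lemma integrable_fine_comp d (T : measurableType d) (m : {measure set T -> \bar R})
  (k : T -> \bar R) : m.-integrable setT k -> m.-integrable setT (EFin \o (fine \o k)).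
Proof.
move=> ki; apply: (le_integrable _ _ _ ki) => //.
  apply/measurable_EFinP; apply: measurableT_comp => //; exact: measurable_int ki.
by move=> x _ /=; case: (k x) => [r| |] //=; rewrite normr0 leey.
Qed.

Lemma integral_fine_comp d (T : measurableType d) (m : {measure set T -> \bar R})
  (k : T -> \bar R) : m.-integrable setT k ->
  fine (\int[m]_x k x)%E = \int[m]_x fine (k x).
Proof.
move=> ki; congr fine; apply: ae_eq_integral => //.
- exact: measurable_int ki.
- exact: measurable_int (integrable_fine_comp ki).
- exact: ae_eq_fine.
Qed.

Lemma integrable_Rfubini1 :
  m1.-integrable setT (EFin \o (fun x => \int[m2]_y f (x, y))).
Proof. exact: (integrable_fine_comp Fi). Qed.

Lemma integrable_Rfubini2 :
  m2.-integrable setT (EFin \o (fun y => \int[m1]_x f (x, y))).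
Proof. exact: (integrable_fine_comp Gi). Qed.

Lemma Rfubini1 : \int[m1]_x \int[m2]_y f (x, y) = \int[(m1 \x m2)%E]_z f z.
Proof.
by rewrite [RHS]/Rintegral -(integral12_prod_meas1 fi) (integral_fine_comp Fi).
Qed.

Lemma Rfubini2 : \int[m2]_y \int[m1]_x f (x, y) = \int[(m1 \x m2)%E]_z f z.
Proof.
by rewrite [RHS]/Rintegral -(integral21_prod_meas1 fi) (integral_fine_comp Gi).
Qed.

End Rintegral_fubini.

(** * Integration by parts for Lebesgue primitives *)

Section primitive_by_parts.
Context {R : realType}.
Notation mu := (@lebesgue_measure R).
Notation leb2 := (mu \x mu)%E.

Lemma integrable_tensor (p q : R -> R) :
  mu.-integrable setT (EFin \o p) -> mu.-integrable setT (EFin \o q) ->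
  leb2.-integrable setT (EFin \o (fun z : R * R => p z.1 * q z.2)).
Proof.
move=> pi qi.
have mp : measurable_fun setT p by apply/measurable_EFinP; exact: measurable_int pi.
have mq : measurable_fun setT q by apply/measurable_EFinP; exact: measurable_int qi.
apply/integrable12ltyP.
  apply/measurable_EFinP; apply: measurable_funM.
    exact: (measurableT_comp mp measurable_fst).
  exact: (measurableT_comp mq measurable_snd).
under eq_integral => x _.
  under eq_integral do rewrite /= normrM EFinM.
  rewrite ge0_integralZl//; last by do 2 apply: measurableT_comp => //.
  over.
rewrite ge0_integralZr//; last 2 first.
- by do 2 apply: measurableT_comp => //.
- exact: integral_ge0.
rewrite lte_mul_pinfty//.
- exact: integral_ge0.
- by case/integrableP : pi => _; rewrite ge0_fin_numE//; exact: integral_ge0.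
- by case/integrableP : qi.
Qed.

Lemma measurable_le_pair : measurable [set z : R * R | z.1 <= z.2].
Proof.
have -> : [set z : R * R | z.1 <= z.2] =
    setT `&` (fun z : R * R => z.1 - z.2) @^-1` `]-oo, 0].
  by apply/seteqP; split => z /=; rewrite in_itv/= subr_le0 => //; case.
apply: (measurable_funB measurable_fst measurable_snd) => //.
Qed.

(** Both terms on the left are integrals of p(x) q(y), over the half-planes x <= y and y < x
    respectively; together they give the integral over the plane, which factors. Fubini thus
    replaces the product rule, and integrability alone is enough. *)
Lemma prim_by_parts (p q : R -> R) :
  mu.-integrable setT (EFin \o p) -> mu.-integrable setT (EFin \o q) ->
  \int[mu]_x (q x * prim p x) + \int[mu]_x (p x * prim q x) =
  (\int[mu]_x p x) * (\int[mu]_x q x).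
Proof.
move=> pi qi.
pose E : set (R * R) := [set z | z.1 <= z.2].
have mE : measurable E := measurable_le_pair.
have pqi := integrable_tensor pi qi.
have leE (x y : R) : (x, y) \in E = (x <= y).
  by apply/idP/idP; rewrite inE.
have fEi (A : set (R * R)) : measurable A -> leb2.-integrable setT
    (EFin \o (fun z : R * R => p z.1 * q z.2 * \1_A z)).
  move=> mA; apply: (@integrable_mul_bounded _ _ _ _ _ _ _ 1) => //.
  by move=> z _; rewrite indicE; case: (_ \in _); rewrite ?normr1 ?normr0.
have -> : \int[mu]_x (q x * prim p x) =
    \int[leb2]_z (p z.1 * q z.2 * \1_E z).
  rewrite -(Rfubini2 (fEi _ mE)); apply: eq_Rintegral => y _ /=.
  rewrite -RintegralZl//; last exact: integrableS pi.
  rewrite Rintegral_mkcond; apply: eq_Rintegral => x _.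
  rewrite patchE indicE leE mem_setE in_itv/=.
  by case: ifP; rewrite ?mulr1 ?mulr0// mulrC.
have -> : \int[mu]_x (p x * prim q x) =
    \int[leb2]_z (p z.1 * q z.2 * \1_(~` E) z).
  rewrite -(Rfubini1 (fEi _ (measurableC mE))); apply: eq_Rintegral => x _ /=.
  (* The complement of [E] is the strict half-plane y < x, so the half-line ending at x is opened at
     the cost of a null point. *)
  rewrite /prim -Rintegral_itv_bndo_bndc; last exact: integrableS qi.
  rewrite -RintegralZl//; last exact: integrableS qi.
  rewrite Rintegral_mkcond; apply: eq_Rintegral => y _.
  rewrite patchE indicE in_setC leE -ltNge mem_setE in_itv/=.
  by case: ifP; rewrite ?mulr1 ?mulr0.
rewrite -RintegralD//; [|exact: fEi|exact/fEi/measurableC].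
transitivity (\int[leb2]_z (p z.1 * q z.2)).
  apply: eq_Rintegral => z _; rewrite -mulrDr !indicE in_setC.
  by case: (_ \in _); rewrite /= ?addr0 ?add0r mulr1.
rewrite -(Rfubini1 pqi) -RintegralZr//; apply: eq_Rintegral => x _.
by rewrite -RintegralZl.
Qed.

End primitive_by_parts.

(** * Weak derivatives on the line *)

Section du_bois_reymond_1d.
Context {R : realType}.
Implicit Types (f g k a b : R -> R) (x al be p q : R).
Notation mu := (@lebesgue_measure R).

Lemma integrable_mul_prim (p q : R -> R) :
  mu.-integrable setT (EFin \o p) -> mu.-integrable setT (EFin \o q) ->
  mu.-integrable setT (EFin \o (fun x => q x * prim p x)).
Proof.
move=> pi qi.
pose E : set (R * R) := [set z | z.1 <= z.2].
have fE : (mu \x mu)%E.-integrable setT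
    (EFin \o (fun z : R * R => p z.1 * q z.2 * \1_E z)).
  apply: (@integrable_mul_bounded _ _ _ _ _ _ _ 1) => //.
  - exact: integrable_tensor.
  - by apply: measurable_indic; exact: measurable_le_pair.
  - by move=> z _; rewrite indicE; case: (_ \in _); rewrite ?normr1 ?normr0.
have := integrable_Rfubini2 fE; congr (_.-integrable _ _).
apply/funext => y /=; congr EFin.
rewrite -RintegralZl//; last exact: integrableS pi.
rewrite [RHS]Rintegral_mkcond; apply: eq_Rintegral => x _.
rewrite patchE indicE.
have -> : ((x, y) \in E) = (x <= y) by apply/idP/idP; rewrite inE.
rewrite mem_setE in_itv/=.
by case: ifP; rewrite ?mulr1 ?mulr0// mulrC.
Qed.

Lemma ae_itv_ex (al be : R) (P : R -> Prop) : al < be ->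
  {ae mu, forall x, al < x < be -> P x} -> exists2 x, al < x < be & P x.
Proof.
move=> ab [N [mN N0 PN]]; apply: contrapT => h.
have : (mu `]al, be[ <= mu N)%E.
  apply: le_measure; rewrite ?inE// => x/=; rewrite in_itv/= => abx.
  by apply: PN => /= Px; apply: h; exists x => //; exact: Px.
rewrite N0 lebesgue_measure_itv/= lte_fin ab -EFinB lee_fin subr_le0.
by rewrite leNgt ab.
Qed.

Lemma smooth_hat_integrable p q : mu.-integrable setT (EFin \o hat p q).
Proof.
apply: (@smooth_integrable _ p q); first exact: smooth_hat.
move=> x h; apply: hat_out; apply: contra h => /andP[px xq].
by rewrite !ltW.
Qed.

Lemma smooth_bumpn_integrable p q n : mu.-integrable setT (EFin \o bumpn p q n).
Proof.
apply: (@smooth_integrable _ p q); first exact: smooth_bumpn.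
move=> x h; apply: bumpn_out; apply: contra h => /andP[px xq].
by rewrite !ltW.
Qed.

Lemma integral_hat_neq0 p q : p < q -> \int[mu]_x hat p q x != 0.
Proof.
move=> pq; apply/negP => /eqP b0.
have bi := smooth_hat_integrable p q.
have bge0 x : 0 <= hat p q x by have /andP[] := hat_itv p q x.
have : (\int[mu]_x `|(EFin \o hat p q) x| = 0)%E.
  under eq_integral do rewrite /= ger0_norm//.
  rewrite -[LHS]fineK; first by congr EFin.
  exact: integrable_fin_num.
move/(ae_eq_integral_abs _ measurableT) => /(_ (measurable_int _ bi)) h.
have [x pxq] : exists2 x, p < x < q & hat p q x = 0.
  by apply: ae_itv_ex => //; apply: filterS h => x /(_ I) [].
by move/eqP; rewrite gt_eqF// hat_gt0.
Qed.

(* A fixed multiple of [hat p0 q0] corrects the integral of [bumpn p q n] to 0, which makes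
   its primitive compactly supported. *)
Definition balanced p0 q0 p q n x : R :=
  bumpn p q n x - (\int[mu]_t bumpn p q n t / \int[mu]_t hat p0 q0 t) * hat p0 q0 x.

Lemma smooth_balanced p0 q0 p q n : smooth (balanced p0 q0 p q n).
Proof.
move=> m; apply: diffnD; first exact: smooth_bumpn.
apply: smooth_opp => j; apply: diffnM; first exact: diffn_cst.
exact: smooth_hat.
Qed.

Lemma balanced_outside p0 q0 p q n :
  vanishes_outside (Num.min p p0) (Num.max q q0) (balanced p0 q0 p q n).
Proof.
move=> x; rewrite negb_and -!ltNge lt_min gt_max => h.
rewrite /balanced bumpn_out ?hat_out ?mulr0 ?subr0// negb_and -!leNgt.
  by case/orP: h => /andP[/ltW h1 /ltW h2]; rewrite ?h1 ?h2 ?orbT.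
by case/orP: h => /andP[/ltW h1 /ltW h2]; rewrite ?h1 ?h2 ?orbT.
Qed.

Lemma balanced_integrable p0 q0 p q n :
  mu.-integrable setT (EFin \o balanced p0 q0 p q n).
Proof.
exact: smooth_integrable (smooth_balanced p0 q0 p q n) (@balanced_outside _ _ _ _ _).
Qed.

Lemma integral_balanced p0 q0 p q n : p0 < q0 ->
  \int[mu]_x balanced p0 q0 p q n x = 0.
Proof.
move=> pq0; rewrite RintegralB//.
- rewrite RintegralZl//; last exact: smooth_hat_integrable.
  by rewrite divfK ?subrr// integral_hat_neq0.
- exact: smooth_bumpn_integrable.
- have := integrableZl measurableT (\int[mu]_t bumpn p q n t / \int[mu]_t hat p0 q0 t)
    (smooth_hat_integrable p0 q0).
  by congr (_.-integrable _ _).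
Qed.

Definition testfun1 (al be : R) a := smooth a /\
  exists p q, [/\ al < p, q < be & vanishes_outside p q a].

Lemma testfun1_derive1 al be a : testfun1 al be a -> testfun1 al be (derive1 a).
Proof.
move=> [sa [p [q [alp qbe apq]]]]; split; first exact: smooth_derive1.
by exists p, q; split => //; exact: vanishes_outside_derive1.
Qed.

Lemma testfun1_mul al be a b : smooth b -> testfun1 al be a ->
  testfun1 al be (fun x => b x * a x).
Proof.
move=> sb [sa [p [q [alp qbe apq]]]]; split; first by move=> n; exact: diffnM.
by exists p, q; split => // x h; rewrite apq// mulr0.
Qed.

Lemma testfun1W al be al' be' a : al' <= al -> be <= be' ->
  testfun1 al be a -> testfun1 al' be' a.
Proof.
move=> aa bb [sa [p [q [alp qbe apq]]]]; split => //.
by exists p, q; split => //; [exact: le_lt_trans alp|exact: lt_le_trans bb].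
Qed.

Lemma testfun1_bumpn al be p q n : al < p -> q < be -> testfun1 al be (bumpn p q n).
Proof.
move=> alp qbe; split; first exact: smooth_bumpn.
exists p, q; split => // x h; apply: bumpn_out; apply: contra h => /andP[px xq].
by rewrite !ltW.
Qed.

Lemma testfun1_bounded al be a : testfun1 al be a -> exists C : R, forall x, `|a x| <= C.
Proof. by move=> [sa [p [q [_ _ apq]]]]; exact: smooth_bounded apq. Qed.

(** These are the tests fed into the weak equations: their derivative is a bump up to a fixed
    multiple of [hat p0 q0]. *)
Lemma testfun1_prim_balanced al be p0 q0 p q n : al < p0 -> p0 < q0 -> q0 < be ->
  al < p -> q < be -> testfun1 al be (prim (balanced p0 q0 p q n)).
Proof.
move=> alp0 pq0 q0be alp qbe; split.
  by apply: smooth_prim; [exact: balanced_integrable|exact: smooth_balanced].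
exists (Num.min p p0), (Num.max q q0); split.
- by rewrite lt_min alp.
- by rewrite gt_max qbe.
- apply: prim_outside; [exact: balanced_integrable|exact: balanced_outside|].
  exact: integral_balanced.
Qed.

Lemma derive1_prim_balanced p0 q0 p q n :
  derive1 (prim (balanced p0 q0 p q n)) = balanced p0 q0 p q n.
Proof.
apply/funext => x; rewrite derive1E.
have [_ ->//] := is_derive_prim (balanced_integrable p0 q0 p q n)
  (smooth_continuous (smooth_balanced p0 q0 p q n) (x:=x)).
Qed.

(** Du Bois-Reymond's lemma. The difference [h] of [f] and [prim g] is orthogonal to every balanced
    bump, since those are derivatives of tests. As a balanced bump is a bump minus a multiple of a
    fixed [hat], the integral of [h] against any bump is a constant [c] times the integral of the
    bump, and [ae0_of_bumpn] applies to [h - c]. *)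
Lemma weak_derivative_prim f g (al be p0 q0 : R) : al < p0 -> p0 < q0 -> q0 < be ->
  mu.-integrable setT (EFin \o f) -> mu.-integrable setT (EFin \o g) ->
  (forall (p q : rat) n, al < ratr p -> ratr q < be ->
    let A := prim (balanced p0 q0 (ratr p) (ratr q) n) in
    \int[mu]_t (f t * derive1 A t + g t * A t) = 0) ->
  exists c : R, {ae mu, forall x, al < x < be -> f x = c + prim g x}.
Proof.
move=> alp0 pq0 q0be fi gi fg0.
pose h x := f x - prim g x.
(* The mean of [h] with weight [hat p0 q0]: the only value for which [h - c] is orthogonal to
   [hat p0 q0]. *)
pose c := \int[mu]_x (h x * hat p0 q0 x) / \int[mu]_x hat p0 q0 x.
exists c.
(* Neither a constant nor a primitive is integrable on the whole line in general; the indicator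
   repairs this and is invisible to tests supported in ]al, be[. *)
pose k x := (h x - c) * \1_(`]al, be[) x.
have i1 : mu.-integrable setT (EFin \o \1_(`]al, be[)) by exact: integrable_indic_itv.
have hbi b : mu.-integrable setT (EFin \o b) -> (exists C : R, forall x, `|b x| <= C) ->
    mu.-integrable setT (EFin \o (fun x => h x * b x)).
  move=> bi [C bC].
  have mb : measurable_fun setT b by apply/measurable_EFinP; exact: measurable_int bi.
  have := integrableB measurableT
    (@integrable_mul_bounded _ _ _ _ _ _ _ C measurableT fi mb (fun x _ => bC x))
    (integrable_mul_prim gi bi).
  congr (_.-integrable _ _); apply/funext => x /=.
  by rewrite -EFinB; congr EFin; rewrite /h; ring.
have cbi (r : R) b : mu.-integrable setT (EFin \o b) ->
    mu.-integrable setT (EFin \o (fun x => r * b x)).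
  by move=> bi; have := integrableZl measurableT r bi; congr (_.-integrable _ _).
have ki : mu.-integrable setT (EFin \o k).
  have := integrableB measurableT (hbi _ i1 _) (cbi c _ i1).
  rewrite (_ : _ \- _ = EFin \o k)%E; last first.
    by apply/funext => x /=; rewrite -EFinB -mulrBl.
  apply; exists 1 => x; rewrite indicE.
  by case: (_ \in _); rewrite ?normr1 ?normr0.
suff : {ae mu, forall x, al < x < be -> k x = 0}.
  apply: filterS; first exact: (ae_filter_ringOfSetsType mu).
  move=> x kx xab; move: (kx xab) => /eqP.
  rewrite /k indicE mem_set/=; last by rewrite in_itv.
  by rewrite mulr1 subr_eq0 subr_eq => /eqP.
have hatN0 := integral_hat_neq0 pq0.
apply: ae0_of_bumpn => // p q n alp qbe.
set b := bumpn (ratr p) (ratr q) n.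
have bi : mu.-integrable setT (EFin \o b) by exact: smooth_bumpn_integrable.
have bB : exists C : R, forall x, `|b x| <= C.
  by apply: (@testfun1_bounded al be); exact: testfun1_bumpn.
have hati := smooth_hat_integrable p0 q0.
have hatB : exists C : R, forall x, `|hat p0 q0 x| <= C.
  by exists 1 => x; have /andP[h0 h1] := hat_itv p0 q0 x; rewrite ger0_norm// ltW.
transitivity (\int[mu]_t (h t * b t - c * b t)).
  apply: eq_Rintegral => t _; rewrite /k /b -mulrBl.
  have [tab|tab] := boolP (al < t < be).
    by rewrite indicE mem_set/= ?in_itv// mulr1.
  rewrite bumpn_out ?mulr0//; apply: contra tab => /andP[pt tq].
  by rewrite (lt_trans alp pt) (lt_trans tq qbe).
rewrite RintegralB//; [|exact: hbi|exact: cbi].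
have := fg0 p q n alp qbe; rewrite /= derive1_prim_balanced.
set a := balanced _ _ _ _ _; set A := prim a.
have ai : mu.-integrable setT (EFin \o a) by exact: balanced_integrable.
have sa : smooth a by exact: smooth_balanced.
have ma : measurable_fun setT a := smooth_measurable sa.
have aB : exists C : R, forall x, `|a x| <= C.
  by apply: smooth_bounded sa _; exact: balanced_outside.
have fai : mu.-integrable setT (EFin \o (fun x => f x * a x)).
  by case: aB => C aC; exact: (@integrable_mul_bounded _ _ _ _ _ _ _ C).
have gAi : mu.-integrable setT (EFin \o (fun x => g x * A x)).
  exact: integrable_mul_prim.
have aGi : mu.-integrable setT (EFin \o (fun x => a x * prim g x)).
  exact: integrable_mul_prim.
rewrite RintegralD// => fagA.
(* The zero mean of [a] kills the product on the right of [prim_by_parts], so that the integral of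
   [g * A] is minus that of [a * prim g]. *)
have a0 : \int[mu]_x a x = 0 by exact: integral_balanced.
have := prim_by_parts gi ai; rewrite a0 mulr0 => GagA.
have {fagA GagA} : \int[mu]_t (h t * a t) = 0.
  transitivity (\int[mu]_t (f t * a t - a t * prim g t)).
    by apply: eq_Rintegral => t _; rewrite /h; ring.
  by rewrite RintegralB//; lra.
set m := (\int[mu]_t b t / \int[mu]_t hat p0 q0 t).
have -> : \int[mu]_t (h t * a t) = \int[mu]_t (h t * b t - m * (h t * hat p0 q0 t)).
  by apply: eq_Rintegral => t _; rewrite /a /balanced -/m -/b; ring.
rewrite RintegralB//; [|exact: hbi|exact/cbi/hbi].
rewrite !RintegralZl//; last exact: hbi.
move=> /eqP; rewrite subr_eq0 => /eqP ->.
by rewrite /m /c; field.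
Qed.

End du_bois_reymond_1d.

(** * The square of a primitive *)

Section slice_bounds.
Context {R : realType}.
Implicit Types (f g w : R -> R) (x y al be c : R).
Notation mu := (@lebesgue_measure R).

(** The chain rule for the square of an absolutely continuous function. It comes from
    [prim_by_parts] applied to the restriction [g1] of [g] and to itself: twice the integral of
    [g1 * prim g1] is the square of the increment of [prim g]. *)
Lemma sqr_prim g c x y : mu.-integrable setT (EFin \o g) -> x <= y ->
  (c + prim g y) ^+ 2 - (c + prim g x) ^+ 2 =
  2 * \int[mu]_(t in `]x, y]) (g t * (c + prim g t)).
Proof.
move=> gi xy.
pose g1 t := g t * \1_(`]x, y]) t.
have i1 : measurable_fun setT (\1_(`]x, y]) : R -> R) by exact: measurable_indic.
have g1i : mu.-integrable setT (EFin \o g1).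
  apply: (@integrable_mul_bounded _ _ _ _ _ _ _ 1) => // t _.
  by rewrite indicE; case: (_ \in _); rewrite ?normr1 ?normr0.
have g1E : \int[mu]_t g1 t = prim g y - prim g x.
  rewrite prim_Rintegral_itv// [RHS]Rintegral_mkcond; apply: eq_Rintegral => t _.
  by rewrite patchE /g1 indicE; case: ifP; rewrite ?mulr1 ?mulr0.
have prim1 t : x < t <= y -> prim g1 t = prim g t - prim g x.
  move=> /andP[xt ty]; rewrite prim_Rintegral_itv ?(ltW xt)//.
  rewrite /prim [LHS]Rintegral_mkcond [RHS]Rintegral_mkcond; apply: eq_Rintegral => s _.
  rewrite !patchE /g1 indicE !mem_setE !in_itv/=.
  have [st|ts] := leP s t; last by rewrite andbF.
  by rewrite (le_trans st ty) andbT; case: (x < s); rewrite ?mulr1 ?mulr0.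
have := prim_by_parts g1i g1i; rewrite g1E -mulr2n.
have g1pi := integrable_mul_prim g1i g1i.
have -> : \int[mu]_(t in `]x, y]) (g t * (c + prim g t)) =
    \int[mu]_t (g1 t * prim g1 t + (c + prim g x) * g1 t).
  rewrite Rintegral_mkcond; apply: eq_Rintegral => t _.
  rewrite patchE {1 3}/g1 indicE mem_setE in_itv/=; case: ifP => xty; last first.
    by rewrite mulr0 mul0r mulr0 addr0.
  by rewrite prim1// mulr1; ring.
rewrite RintegralD//; last first.
  by have := integrableZl measurableT (c + prim g x) g1i; congr (_.-integrable _ _).
rewrite RintegralZl// g1E => E1.
by rewrite mulrDr mulr_natl E1; ring.
Qed.

(** On each ]-n, n[ the primitive agrees with its product by the indicator, which
    [integrable_mul_prim] shows to be integrable. *)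
Lemma measurable_prim g : mu.-integrable setT (EFin \o g) -> measurable_fun setT (prim g).
Proof.
move=> gi; rewrite -(bigcup_itvT false true).
apply/measurable_fun_bigcup => // n.
have i1 : mu.-integrable setT (EFin \o \1_(`]- n%:R, n%:R[)).
  exact: integrable_indic_itv.
have /measurable_EFinP h := measurable_int _ (integrable_mul_prim gi i1).
apply: eq_measurable_fun (measurable_funTS h) => x xn.
by rewrite indicE xn mul1r.
Qed.

Lemma prim_bounded g x : mu.-integrable setT (EFin \o g) ->
  `|prim g x| <= \int[mu]_t `|g t|.
Proof.
move=> gi; apply: le_trans (le_normr_Rintegral _ _) _ => //; first exact: integrableS gi.
rewrite Rintegral_mkcond; apply: le_Rintegral => //.
- have : mu.-integrable `]-oo, x] (EFin \o (fun t => `|g t|)).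
    by apply: integrable_norm; exact: integrableS gi.
  by move/(integrable_mkcond _ _).1; rewrite restrict_EFin; apply.
- exact: integrable_norm.
- by move=> t _; rewrite patchE; case: ifP => // _; exact: normr_ge0.
Qed.

Lemma ae_prim_sqr_le f g c al be x y : mu.-integrable setT (EFin \o g) ->
  measurable_fun setT f ->
  {ae mu, forall t, al < t < be -> f t = c + prim g t} ->
  al < x -> x <= y -> y < be ->
  (`|(c + prim g y) ^+ 2 - (c + prim g x) ^+ 2|%:E <=
    2%:E * \int[mu]_(t in `]x, y]) `|f t * g t|%:E)%E.
Proof.
move=> gi mf fF alx xy ybe; rewrite sqr_prim// normrM EFinM ger0_norm//.
rewrite lee_pmul2l//.
pose F t := c + prim g t.
have mF : measurable_fun setT F by apply: measurable_funD => //; exact: measurable_prim.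
have mg : measurable_fun setT g by apply/measurable_EFinP; exact: measurable_int gi.
have gFi : mu.-integrable `]x, y] (EFin \o (fun t => g t * F t)).
  apply: (@integrable_mul_bounded _ _ _ _ _ _ _ (`|c| + \int[mu]_t `|g t|)) => //.
  - exact: integrableS gi.
  - exact: measurable_funTS.
  - by move=> t _; rewrite (le_trans (ler_normD _ _))// lerD2l prim_bounded.
rewrite EFin_normr_Rintegral//.
apply: le_trans (le_abse_integral _ _ _) _ => //.
  exact: measurable_int gFi.
rewrite le_eqVlt; apply/orP; left; apply/eqP.
apply: ae_eq_integral => //.
- by apply: measurableT_comp => //; exact: measurable_int gFi.
- by apply: measurable_funTS; do 2 apply: measurableT_comp => //; exact: measurable_funM.
- apply: filterS fF; first exact: (ae_filter_ringOfSetsType mu).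
  move=> t + txy; rewrite /= => ->; first by rewrite mulrC.
  by move: txy; rewrite /= in_itv/= => /andP[/(lt_trans alx)-> /le_lt_trans->].
Qed.

(* The zero boundary value of a function at [al0] is encoded by its vanishing on ]al, al0[. *)
Lemma ae_sqr_le_of_zero f g c al al0 be : al < al0 -> al0 < be ->
  mu.-integrable setT (EFin \o g) -> measurable_fun setT f ->
  {ae mu, forall t, al < t < be -> f t = c + prim g t} ->
  (forall t, al < t < al0 -> f t = 0) ->
  {ae mu, forall t, al0 < t < be ->
    ((f t ^+ 2)%:E <= 2%:E * \int[mu]_s `|f s * g s|%:E)%E}.
Proof.
move=> al0al al0be gi mf fF f0.
(* The representation holds only almost everywhere, so the base point is taken in ]al, al0[, where
   [f] is 0, rather than at [al0]. *)
have [x0 x0al Fx0] : exists2 x, al < x < al0 & 0 = c + prim g x.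
  apply: ae_itv_ex => //; apply: filterS fF; first exact: (ae_filter_ringOfSetsType mu).
  move=> x xF xal; rewrite -xF ?f0//.
  by have /andP[-> /lt_trans->] := xal.
have /andP[x01 x02] := x0al.
have mfg : measurable_fun setT (fun s => `|f s * g s|%:E).
  do 2 apply: measurableT_comp => //; apply: measurable_funM => //.
  by apply/measurable_EFinP; exact: measurable_int gi.
have := fF; apply: filterS; first exact: (ae_filter_ringOfSetsType mu).
move=> t Ft /andP[al0t tbe]; rewrite Ft ?(lt_trans al0al)//.
have x0t : x0 <= t by rewrite ltW// (lt_trans x02).
have := ae_prim_sqr_le gi mf fF x01 x0t tbe.
rewrite -Fx0 expr0n subr0 ger0_norm ?sqr_ge0// => /le_trans; apply.
rewrite lee_pmul2l//; apply: ge0_subset_integral => //.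
Qed.

(** Were the bound to fail at x by some [d > 0], then [w y * f y ^+ 2 >= d] for almost every y > x,
    against the finiteness of the integral of [w * f ^+ 2]. Primitives are available on bounded
    intervals ]al, M[ only, with a constant depending on M; only increments of the square are used,
    so the constants disappear. *)
Lemma ae_sqr_le_decay f g w al : measurable_fun setT f -> measurable_fun setT g ->
  measurable_fun setT w ->
  (forall x, 0 <= w x) -> (forall x y, al < x -> x <= y -> w x <= w y) ->
  (forall M : nat, mu.-integrable setT (EFin \o (g \_ `]al, M%:R[))) ->
  (forall M : nat, exists c, {ae mu, forall x, al < x < M%:R ->
     f x = c + prim (g \_ `]al, M%:R[) x}) ->
  (\int[mu]_(x in `]al, +oo[) (w x * f x ^+ 2)%:E < +oo)%E ->
  {ae mu, forall x, al < x ->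
    ((w x * f x ^+ 2)%:E <= 2%:E * \int[mu]_(t in `]al, +oo[) (w t * `|f t * g t|)%:E)%E}.
Proof.
move=> mf mg mw w0 wmono gi fg fin.
pose K := (\int[mu]_(t in `]al, +oo[) (w t * `|f t * g t|)%:E)%E.
have /choice[c fF] := fg.
have /ae_foralln fFall := fF.
have := fFall; apply: filterS.
move=> x Fx alx; rewrite leNgt; apply/negP => Kx.
have mwfg : measurable_fun setT (fun t => (w t * `|f t * g t|)%:E).
  apply: measurableT_comp => //; apply: measurable_funM => //.
  by apply: measurableT_comp => //; exact: measurable_funM.
have K0 : (0 <= K)%E by apply: integral_ge0 => t _; rewrite lee_fin mulr_ge0.
(* An infinite right-hand side could not have been exceeded at x. *)
have Koo : (K < +oo)%E.
  rewrite ltNge leye_eq; apply/negP => /eqP Koo.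
  by move: Kx; rewrite -/K Koo gt0_muley// ltNge leey.
have KE : K = (fine K)%:E by rewrite fineK// ge0_fin_numE.
move: Kx; rewrite -/K KE -EFinM lte_fin -subr_gt0; set d := _ - _ => d0.
have step (M : nat) y : x < y < M%:R -> f y = c M + prim (g \_ `]al, M%:R[) y ->
    d <= w y * f y ^+ 2.
  move=> /andP[xy yM] Fy.
  have := ae_prim_sqr_le (gi M) mf (fF M) alx (ltW xy) yM.
  rewrite -Fy -(Fx M) ?alx ?(lt_trans xy)// => le1.
  (* Monotonicity of the weight: [w x <= w t] on ]x, y], so [w x] may enter the integral as
     [w t]. *)
  have : ((w x)%:E * `|f y ^+ 2 - f x ^+ 2|%:E <= 2%:E * K)%E.
    apply: (@le_trans _ _ ((w x)%:E * (2%:E * \int[mu]_(t in `]x, y]) `|f t * g t|%:E))%E).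
      rewrite lee_wpmul2l ?lee_fin//; apply: le_trans le1 _.
      rewrite le_eqVlt; apply/orP; left; apply/eqP; congr (_ * _)%E.
      apply: eq_integral => t; rewrite inE/= in_itv/= => /andP[xt ty].
      by rewrite patchE mem_set//= in_itv/= (lt_trans alx xt) (le_lt_trans ty yM).
    rewrite muleCA lee_pmul2l// -ge0_integralZl//; last first.
    - by rewrite lee_fin.
    - by apply: measurable_funTS; do 2 apply: measurableT_comp => //; exact: measurable_funM.
    apply: (@le_trans _ _ (\int[mu]_(t in `]x, y]) (w t * `|f t * g t|)%:E)%E).
      apply: ge0_le_integral => //.
      - by move=> t _; rewrite mule_ge0// lee_fin.
      - apply: measurable_funeM.
        by apply: measurable_funTS; do 2 apply: measurableT_comp => //; exact: measurable_funM.
      - exact: measurable_funTS.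
      - move=> t; rewrite /= in_itv/= => /andP[xt ty].
        by rewrite -EFinM lee_fin ler_wpM2r// wmono// ltW.
    apply: ge0_subset_integral => //.
    - exact: measurable_funTS.
    - by move=> t _; rewrite lee_fin mulr_ge0.
    - by move=> t /=; rewrite !in_itv/= andbT => /andP[/(lt_trans alx)->].
  rewrite KE -!EFinM lee_fin => le2.
  have le3 : w x * f x ^+ 2 <= w x * f y ^+ 2 + w x * `|f y ^+ 2 - f x ^+ 2|.
    rewrite -mulrDr ler_wpM2l// -lerBlDl -normrN opprB; exact: ler_norm.
  have le4 : w x * f y ^+ 2 <= w y * f y ^+ 2.
    by rewrite ler_wpM2r ?sqr_ge0// wmono// ltW.
  by rewrite /d; lra.
suff : (+oo <= \int[mu]_(x in `]al, +oo[) (w x * f x ^+ 2)%:E)%E.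
  by rewrite leye_eq => /eqP E; move: fin; rewrite E.
have mwf : measurable_fun setT (fun t => (w t * f t ^+ 2)%:E).
  apply: measurableT_comp => //; apply: measurable_funM => //; exact: measurable_funX.
apply: (@le_trans _ _ (\int[mu]_(t in `]x, +oo[) (w t * f t ^+ 2)%:E)%E); last first.
  apply: ge0_subset_integral => //.
  - exact: measurable_funTS.
  - by move=> t _; rewrite lee_fin mulr_ge0 ?sqr_ge0.
  - by move=> t /=; rewrite !in_itv/= !andbT; exact: lt_trans.
apply: (@le_trans _ _ (\int[mu]_(t in `]x, +oo[) d%:E)%E).
  rewrite integral_cst//.
  apply: (@le_trans _ _ (d%:E * mu `]x, +oo[)%E); last exact: lexx.
  by rewrite lebesgue_measure_itv/= ltry gt0_muley// lte_fin.
apply: ae_ge0_le_integral => //.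
- by move=> t _; rewrite lee_fin ltW.
- by move=> t _; rewrite lee_fin mulr_ge0 ?sqr_ge0.
- exact: measurable_funTS.
have := fFall; apply: filterS.
move=> t Ft; rewrite /= in_itv/= andbT => xt; rewrite lee_fin.
have [M tM] : exists M : nat, t < M%:R.
  exists (Num.truncn `|t|).+1; apply: le_lt_trans (ler_norm t) _; exact: truncnS_gt.
by apply: (step M); [rewrite xt|apply: Ft; rewrite tM (lt_trans alx)].
Qed.

End slice_bounds.

(** * Weak derivatives on almost every line *)

Section tensor.
Context {R : realType}.
Implicit Types (a b : R -> R) (al be ga ka : R).
Notation mu := (@lebesgue_measure R).
Notation leb2 := (mu \x mu)%E.

Definition tensor a b (z : R * R) : R := a z.1 * b z.2.

Lemma d_omega_tensor a b : smooth a -> d_omega (tensor a b) = tensor (derive1 a) b.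
Proof.
move=> sa; apply/funext => z; rewrite /d_omega /tensor derive1E.
have Da := diffn_is_derive (sa 1%N) z.1.
rewrite (_ : (fun _ => _) = b z.2 *: a); last first.
  by apply/funext => s; rewrite mulrC.
by rewrite deriveZ//= derive1E mulrC.
Qed.

Lemma d_R_tensor a b : smooth b -> d_R (tensor a b) = tensor a (derive1 b).
Proof.
move=> sb; apply/funext => z; rewrite /d_R /tensor derive1E.
have Db := diffn_is_derive (sb 1%N) z.2.
rewrite (_ : (fun _ => _) = a z.1 *: b); last by [].
by rewrite deriveZ//= derive1E.
Qed.

Lemma continuous_tensor a b : continuous a -> continuous b -> continuous (tensor a b).
Proof.
move=> ca cb z; apply: cvgM.
  by apply: continuous_comp; [exact: cvg_fst|exact: ca].
by apply: continuous_comp; [exact: cvg_snd|exact: cb].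
Qed.

Lemma Ck_tensor n a b : smooth a -> smooth b -> Ck n (tensor a b).
Proof.
elim: n a b => [|n IH] a b sa sb /=; split=> //.
- by apply: continuous_tensor; exact: smooth_continuous.
- by apply: continuous_tensor; exact: smooth_continuous.
split.
- move=> z; rewrite /tensor /=.
  rewrite (_ : (fun _ => _) = b z.2 *: a); last first.
    by apply/funext => s; rewrite mulrC.
  by apply: derivableZ; exact: smooth_derivable.
- move=> z; rewrite /tensor /=.
  rewrite (_ : (fun _ => _) = a z.1 *: b); last by [].
  by apply: derivableZ; exact: smooth_derivable.
- by rewrite d_omega_tensor//; apply: IH => //; exact: smooth_derive1.
- by rewrite d_R_tensor//; apply: IH => //; exact: smooth_derive1.
Qed.

Lemma tensor_test_function (U : set (R * R)) al be ga ka a b :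
  testfun1 al be a -> testfun1 ga ka b ->
  (forall z, al < z.1 < be -> ga < z.2 < ka -> U z) ->
  test_function U (tensor a b).
Proof.
move=> [sa [p [q [alp qbe apq]]]] [sb [p' [q' [gap' q'ka bpq]]]] hU.
pose K : set (R * R) := `[p, q] `*` `[p', q'].
have cK : compact K by apply: compact_setX; exact: segment_compact.
have clK : closed K.
  apply: compact_closed cK.
  exact: norm_hausdorff.
have suppK : closure [set z | tensor a b z != 0] `<=` K.
  rewrite [X in _ `<=` X](closure_id _).1//; apply: closure_subset => z /=.
  rewrite mulf_eq0 negb_or => /andP[az bz]; split; rewrite /= in_itv/=.
    by apply: contraNT az => /apq ->.
  by apply: contraNT bz => /bpq ->.
split.
- by move=> n; exact: Ck_tensor.
- by apply: subclosed_compact cK suppK; exact: closed_closure.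
- move=> z /suppK[]; rewrite /= !in_itv/= => /andP[pz zq] /andP[p'z zq'].
  by apply: hU; rewrite ?(lt_le_trans alp)// ?(lt_le_trans gap')//
    ?(le_lt_trans zq)// ?(le_lt_trans zq').
Qed.

End tensor.

(** * Slices of integrable functions on the plane *)

Section slices.
Context {R : realType}.
Implicit Types (P : R * R -> R) (a b : R -> R) (al be : R).
Notation mu := (@lebesgue_measure R).
Notation leb2 := (mu \x mu)%E.

Lemma integrable_mul_fst P a (C : R) : leb2.-integrable setT (EFin \o P) ->
  measurable_fun setT a -> (forall x, `|a x| <= C) ->
  leb2.-integrable setT (EFin \o (fun z => P z * a z.1)).
Proof.
move=> Pi ma aC; apply: (@integrable_mul_bounded _ _ _ _ _ _ _ C) => //.
exact: (measurableT_comp ma measurable_fst).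
Qed.

Lemma integrable_mul_snd P b (C : R) : leb2.-integrable setT (EFin \o P) ->
  measurable_fun setT b -> (forall x, `|b x| <= C) ->
  leb2.-integrable setT (EFin \o (fun z => P z * b z.2)).
Proof.
move=> Pi mb bC; apply: (@integrable_mul_bounded _ _ _ _ _ _ _ C) => //.
exact: (measurableT_comp mb measurable_snd).
Qed.

Lemma integral_slice1 P a (C : R) : leb2.-integrable setT (EFin \o P) ->
  measurable_fun setT a -> (forall x, `|a x| <= C) ->
  \int[leb2]_z (P z * a z.1) = \int[mu]_x (\int[mu]_y P (x, y) * a x).
Proof.
move=> Pi ma aC; rewrite -(Rfubini1 (integrable_mul_fst Pi ma aC)).
rewrite /Rintegral; congr fine; apply: ae_eq_integral => //.
- exact: measurable_int (integrable_Rfubini1 (integrable_mul_fst Pi ma aC)).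
- apply: measurableT_comp => //; apply: measurable_funM => //.
  apply/measurable_EFinP; exact: measurable_int (integrable_Rfubini1 Pi).
- have := ae_integrable1 Pi; apply: filterS => x Px _.
  by congr EFin; exact: (RintegralZr (a x) measurableT Px).
Qed.

Lemma integral_slice2 P b (C : R) : leb2.-integrable setT (EFin \o P) ->
  measurable_fun setT b -> (forall x, `|b x| <= C) ->
  \int[leb2]_z (P z * b z.2) = \int[mu]_y (\int[mu]_x P (x, y) * b y).
Proof.
move=> Pi mb bC; rewrite -(Rfubini2 (integrable_mul_snd Pi mb bC)).
rewrite /Rintegral; congr fine; apply: ae_eq_integral => //.
- exact: measurable_int (integrable_Rfubini2 (integrable_mul_snd Pi mb bC)).
- apply: measurableT_comp => //; apply: measurable_funM => //.
  apply/measurable_EFinP; exact: measurable_int (integrable_Rfubini2 Pi).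
- have := ae_integrable2 Pi; apply: filterS => x Px _.
  by congr EFin; exact: (RintegralZr (b x) measurableT Px).
Qed.

Lemma ae_slice1_eq0 P al be : leb2.-integrable setT (EFin \o P) ->
  (forall a, testfun1 al be a -> \int[leb2]_z (P z * a z.1) = 0) ->
  {ae mu, forall x, al < x < be -> \int[mu]_y P (x, y) = 0}.
Proof.
move=> Pi P0; apply: ae0_of_bumpn; first exact: integrable_Rfubini1.
move=> p q n alp qbe; have tb := testfun1_bumpn n alp qbe.
have [C bC] := testfun1_bounded tb.
by rewrite -(integral_slice1 Pi _ bC) ?P0//; apply: smooth_measurable; case: tb.
Qed.

Lemma ae_slice2_eq0 P al be : leb2.-integrable setT (EFin \o P) ->
  (forall b, testfun1 al be b -> \int[leb2]_z (P z * b z.2) = 0) ->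
  {ae mu, forall y, al < y < be -> \int[mu]_x P (x, y) = 0}.
Proof.
move=> Pi P0; apply: ae0_of_bumpn; first exact: integrable_Rfubini2.
move=> p q n alp qbe; have tb := testfun1_bumpn n alp qbe.
have [C bC] := testfun1_bounded tb.
by rewrite -(integral_slice2 Pi _ bC) ?P0//; apply: smooth_measurable; case: tb.
Qed.

(** The integral of [P] over almost every line x = const vanishes, so orthogonality passes from test
    functions to bounded multipliers. In particular the multiplier may be nonzero at the ends of
    ]al, be[, as the trace argument requires. *)
Lemma integral_mul_fst_eq0 P al be a (C : R) : leb2.-integrable setT (EFin \o P) ->
  (forall z, ~~ (al < z.1 < be) -> P z = 0) ->
  (forall a, testfun1 al be a -> \int[leb2]_z (P z * a z.1) = 0) ->
  measurable_fun setT a -> (forall x, `|a x| <= C) ->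
  \int[leb2]_z (P z * a z.1) = 0.
Proof.
move=> Pi Pout P0 ma aC; rewrite (integral_slice1 Pi ma aC).
rewrite /Rintegral (_ : 0 = fine 0%E)//; congr fine.
rewrite -(integral0 mu setT); apply: ae_eq_integral => //.
- apply: measurableT_comp => //; apply: measurable_funM => //.
  apply/measurable_EFinP; exact: measurable_int (integrable_Rfubini1 Pi).
- have := ae_slice1_eq0 Pi P0; apply: filterS.
    exact: (ae_filter_ringOfSetsType mu).
  move=> x Px _ /=.
  suff h : \int[mu]_y P (x, y) = 0 by apply: congr1; rewrite -[RHS](mul0r (a x)) -h.
  have [/Px//|xab] := boolP (al < x < be).
  by rewrite /Rintegral integral0_eq// => y _; rewrite Pout.
Qed.

End slices.

(** * Absolutely continuous representatives on almost every line *)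

Section slice_primitives.
Context {R : realType}.
Implicit Types (F G : R * R -> R) (a b A B : R -> R) (al be ga ka : R).
Notation mu := (@lebesgue_measure R).
Notation leb2 := (mu \x mu)%E.

Lemma ae_forall_count d (T : measurableType d) (m : {measure set T -> \bar R})
    (I : countType) (P : I -> T -> Prop) :
  (forall i, {ae m, forall x, P i x}) -> {ae m, forall x, forall i, P i x}.
Proof.
move=> aeP.
have : {ae m, forall x, forall n, if unpickle n is Some i then P i x else True}.
  apply: ae_foralln => n; case: (unpickle n) => [i|]; first exact: aeP.
  exact: aeW.
by apply: filterS => x Px i; have := Px (pickle i); rewrite pickleK.
Qed.

Lemma tensor_bounded al be ga ka a b : testfun1 al be a -> testfun1 ga ka b ->
  exists C : R, forall z, `|tensor a b z| <= C.
Proof.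
move=> /testfun1_bounded[C aC] /testfun1_bounded[D bD]; exists (C * D) => z.
by rewrite normrM ler_pM.
Qed.

Lemma integrable_tensor_mul F al be ga ka a b : leb2.-integrable setT (EFin \o F) ->
  testfun1 al be a -> testfun1 ga ka b ->
  leb2.-integrable setT (EFin \o (fun z => F z * tensor a b z)).
Proof.
move=> Fi ta tb; have [C abC] := tensor_bounded ta tb.
apply: (@integrable_mul_bounded _ _ _ _ _ _ _ C) => //.
apply: measurable_funM.
- by apply: measurableT_comp measurable_fst; apply: smooth_measurable; case: ta.
- by apply: measurableT_comp measurable_snd; apply: smooth_measurable; case: tb.
Qed.

(** The weak equation is kept for products only: this is all that slicing uses. [F] and [G] live on
    the whole plane, so a rectangle reaching beyond the domain expresses a zero trace. *)
Definition weak_tensor1 al be ga ka F G := forall A b,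
  testfun1 al be A -> testfun1 ga ka b ->
  \int[leb2]_z (F z * tensor (derive1 A) b z) = - \int[leb2]_z (G z * tensor A b z).

Definition weak_tensor2 al be ga ka F G := forall a B,
  testfun1 al be a -> testfun1 ga ka B ->
  \int[leb2]_z (F z * tensor a (derive1 B) z) = - \int[leb2]_z (G z * tensor a B z).

(** For a fixed test [A], letting [b] vary gives the one-dimensional equation on almost every line.
    The tests of [weak_derivative_prim] form a countable family, so almost every line is good for
    all of them at once. *)
Lemma ae_slice2_prim al be ga ka F G : al < be ->
  leb2.-integrable setT (EFin \o F) -> leb2.-integrable setT (EFin \o G) ->
  weak_tensor1 al be ga ka F G ->
  {ae mu, forall y, ga < y < ka -> exists c, {ae mu, forall x, al < x < be ->
    F (x, y) = c + prim (fun s => G (s, y)) x}}.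
Proof.
move=> ab Fi Gi FG.
have [p0 p01] : exists p0, al < p0 < be by exists ((al + be) / 2); lra.
have /andP[alp0 p0be] := p01.
have [q0 q01] : exists q0, p0 < q0 < be by exists ((p0 + be) / 2); lra.
have /andP[pq0 q0be] := q01.
(* The index consists of the two rational endpoints of a bump and its exponent; the correcting
   interval ]p0, q0[ is fixed once for all lines. *)
pose A (i : rat * rat * nat) := prim (balanced p0 q0 (ratr i.1.1) (ratr i.1.2) i.2).
pose P i z := F z * derive1 (A i) z.1 + G z * A i z.1.
have AP i : al < ratr i.1.1 -> ratr i.1.2 < be ->
    [/\ testfun1 al be (A i), leb2.-integrable setT (EFin \o (fun z => F z * derive1 (A i) z.1)),
     leb2.-integrable setT (EFin \o (fun z => G z * A i z.1)) &
     leb2.-integrable setT (EFin \o P i)].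
  move=> alp qbe.
  have tA : testfun1 al be (A i) by exact: testfun1_prim_balanced.
  have tA' := testfun1_derive1 tA.
  have [C AC] := testfun1_bounded tA; have [C' AC'] := testfun1_bounded tA'.
  have F' : leb2.-integrable setT (EFin \o (fun z => F z * derive1 (A i) z.1)).
    by apply: (integrable_mul_fst Fi _ AC'); apply: smooth_measurable; case: tA'.
  have G' : leb2.-integrable setT (EFin \o (fun z => G z * A i z.1)).
    by apply: (integrable_mul_fst Gi _ AC); apply: smooth_measurable; case: tA.
  by split => //; have := integrableD measurableT F' G'; congr (_.-integrable _ _).
have /ae_forall_count H : forall i, {ae mu, forall y, al < ratr i.1.1 -> ratr i.1.2 < be ->
    ga < y < ka -> \int[mu]_x P i (x, y) = 0}.
  move=> i; have [alp|alp] := boolP (al < ratr i.1.1); last by apply: aeW.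
  have [qbe|qbe] := boolP (ratr i.1.2 < be); last by apply: aeW.
  have [tA F' G' Pi] := AP i alp qbe.
  have : {ae mu, forall y, ga < y < ka -> \int[mu]_x P i (x, y) = 0}.
    apply: ae_slice2_eq0 => // b tb.
    transitivity (\int[leb2]_z (F z * tensor (derive1 (A i)) b z + G z * tensor (A i) b z)).
      by apply: eq_Rintegral => z _; rewrite /P /tensor; ring.
    rewrite RintegralD//.
    - by rewrite FG// addNr.
    - exact: integrable_tensor_mul Fi (testfun1_derive1 tA) tb.
    - exact: integrable_tensor_mul Gi tA tb.
  apply: filterS; first exact: (ae_filter_ringOfSetsType mu).
  by move=> y h _ _.
have HF := ae_integrable2 Fi; have HG := ae_integrable2 Gi.
apply: filterS3 H HF HG => y H Fy Gy yk.
apply: (weak_derivative_prim alp0 pq0 q0be Fy Gy) => p q n alp qbe.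
by have := H (p, q, n) alp qbe yk.
Qed.

Lemma ae_slice1_prim al be ga ka F G : ga < ka ->
  leb2.-integrable setT (EFin \o F) -> leb2.-integrable setT (EFin \o G) ->
  weak_tensor2 al be ga ka F G ->
  {ae mu, forall x, al < x < be -> exists c, {ae mu, forall y, ga < y < ka ->
    F (x, y) = c + prim (fun s => G (x, s)) y}}.
Proof.
move=> ab Fi Gi FG.
have [p0 p01] : exists p0, ga < p0 < ka by exists ((ga + ka) / 2); lra.
have /andP[gap0 p0ka] := p01.
have [q0 q01] : exists q0, p0 < q0 < ka by exists ((p0 + ka) / 2); lra.
have /andP[pq0 q0ka] := q01.
pose A (i : rat * rat * nat) := prim (balanced p0 q0 (ratr i.1.1) (ratr i.1.2) i.2).
pose P i z := F z * derive1 (A i) z.2 + G z * A i z.2.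
have AP i : ga < ratr i.1.1 -> ratr i.1.2 < ka ->
    [/\ testfun1 ga ka (A i), leb2.-integrable setT (EFin \o (fun z => F z * derive1 (A i) z.2)),
     leb2.-integrable setT (EFin \o (fun z => G z * A i z.2)) &
     leb2.-integrable setT (EFin \o P i)].
  move=> gap qka.
  have tA : testfun1 ga ka (A i) by exact: testfun1_prim_balanced.
  have tA' := testfun1_derive1 tA.
  have [C AC] := testfun1_bounded tA; have [C' AC'] := testfun1_bounded tA'.
  have F' : leb2.-integrable setT (EFin \o (fun z => F z * derive1 (A i) z.2)).
    by apply: (integrable_mul_snd Fi _ AC'); apply: smooth_measurable; case: tA'.
  have G' : leb2.-integrable setT (EFin \o (fun z => G z * A i z.2)).
    by apply: (integrable_mul_snd Gi _ AC); apply: smooth_measurable; case: tA.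
  by split => //; have := integrableD measurableT F' G'; congr (_.-integrable _ _).
have /ae_forall_count H : forall i, {ae mu, forall x, ga < ratr i.1.1 -> ratr i.1.2 < ka ->
    al < x < be -> \int[mu]_y P i (x, y) = 0}.
  move=> i; have [gap|gap] := boolP (ga < ratr i.1.1); last by apply: aeW.
  have [qka|qka] := boolP (ratr i.1.2 < ka); last by apply: aeW.
  have [tA F' G' Pi] := AP i gap qka.
  have : {ae mu, forall x, al < x < be -> \int[mu]_y P i (x, y) = 0}.
    apply: ae_slice1_eq0 => // a ta.
    transitivity (\int[leb2]_z (F z * tensor a (derive1 (A i)) z + G z * tensor a (A i) z)).
      by apply: eq_Rintegral => z _; rewrite /P /tensor; ring.
    rewrite RintegralD//.
    - by rewrite FG// addNr.
    - exact: integrable_tensor_mul Fi ta (testfun1_derive1 tA).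
    - exact: integrable_tensor_mul Gi ta tA.
  apply: filterS; first exact: (ae_filter_ringOfSetsType mu).
  by move=> y h _ _.
have HF := ae_integrable1 Fi; have HG := ae_integrable1 Gi.
apply: filterS3 H HF HG => x H Fx Gx xk.
apply: (weak_derivative_prim gap0 pq0 q0ka Fx Gx) => p q n gap qka.
by have := H (p, q, n) gap qka xk.
Qed.

End slice_primitives.

(** * Traces *)

Section trace.
Context {R : realType}.
Implicit Types (F G V W : R * R -> R) (a b r : R -> R).
Notation mu := (@lebesgue_measure R).
Notation leb2 := (mu \x mu)%E.

(* [F = - d_2 (r V)] inherits the zero trace of [V] at [x = al0], because [r] depends
   on [y] only: when [A] does not vanish near [al0],
   [int F A' b = int r V A' b' = - int W r A b' = - int G A b].
   The first and the last equality hold for test functions [A] supported in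
   ]al0, be[; as no derivative of [A] is moved there, they extend to bounded [A]. *)
Lemma weak_tensor1_trace (al al0 be ga ka : R) F G V W r : al <= al0 ->
  leb2.-integrable setT (EFin \o F) -> leb2.-integrable setT (EFin \o G) ->
  leb2.-integrable setT (EFin \o V) -> leb2.-integrable setT (EFin \o W) ->
  leb2.-integrable setT (EFin \o (fun z => r z.2 * V z)) ->
  smooth r ->
  (forall z, ~~ (al0 < z.1 < be) -> [/\ F z = 0, G z = 0, V z = 0 & W z = 0]) ->
  weak_tensor2 al0 be ga ka (fun z => r z.2 * V z) (fun z => - F z) ->
  weak_tensor1 al be ga ka V W ->
  weak_tensor1 al0 be ga ka F G ->
  weak_tensor1 al be ga ka F G.
Proof.
move=> al0al Fi Gi Vi Wi rVi sr out rVF VW FG A b tA tb.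
have tb' := testfun1_derive1 tb.
have trb' := testfun1_mul sr tb'.
have tA' := testfun1_derive1 tA.
have [CA AC] := testfun1_bounded tA; have [CA' AC'] := testfun1_bounded tA'.
have [Cb bC] := testfun1_bounded tb; have [Cb' bC'] := testfun1_bounded tb'.
have [Crb rbC] := testfun1_bounded trb'.
have m al1 be1 c : testfun1 al1 be1 c -> measurable_fun setT c.
  by case=> sc _; exact: smooth_measurable.
have rVF' a : testfun1 al0 be a ->
    \int[leb2]_z (r z.2 * V z * tensor a (derive1 b) z) = \int[leb2]_z (F z * tensor a b z).
  move=> ta; rewrite rVF//.
  transitivity (- \int[leb2]_z (- 1 * (F z * tensor a b z))).
    by congr (- _); apply: eq_Rintegral => z _; ring.
  by rewrite RintegralZl ?mulN1r ?opprK//; exact: integrable_tensor_mul Fi ta tb.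
(* [P] and, below, [Q] are the defects of the first and of the last equality with the factor in x
   removed; what must be shown is that they are orthogonal to [derive1 A] and to [A]. *)
pose P z := r z.2 * V z * derive1 b z.2 - F z * b z.2.
have P1i : leb2.-integrable setT (EFin \o (fun z => r z.2 * V z * derive1 b z.2)).
  exact: (integrable_mul_snd rVi (m _ _ _ _ tb') bC').
have P2i : leb2.-integrable setT (EFin \o (fun z => F z * b z.2)).
  exact: (integrable_mul_snd Fi (m _ _ _ _ tb) bC).
have Pi : leb2.-integrable setT (EFin \o P).
  by have := integrableB measurableT P1i P2i; congr (_.-integrable _ _).
pose Q z := W z * (r z.2 * derive1 b z.2) - G z * b z.2.
have Q1i : leb2.-integrable setT (EFin \o (fun z => W z * (r z.2 * derive1 b z.2))).
  exact: (integrable_mul_snd Wi (m _ _ _ _ trb') rbC).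
have Q2i : leb2.-integrable setT (EFin \o (fun z => G z * b z.2)).
  exact: (integrable_mul_snd Gi (m _ _ _ _ tb) bC).
have Qi : leb2.-integrable setT (EFin \o Q).
  by have := integrableB measurableT Q1i Q2i; congr (_.-integrable _ _).
have P0 a : testfun1 al0 be a -> \int[leb2]_z (P z * a z.1) = 0.
  move=> ta; transitivity (\int[leb2]_z
      (r z.2 * V z * tensor a (derive1 b) z - F z * tensor a b z)).
    by apply: eq_Rintegral => z _; rewrite /P /tensor; ring.
  rewrite RintegralB//.
  - by rewrite rVF'// subrr.
  - exact: integrable_tensor_mul rVi ta tb'.
  - exact: integrable_tensor_mul Fi ta tb.
have Q0 a : testfun1 al0 be a -> \int[leb2]_z (Q z * a z.1) = 0.
  (* For tests supported away from [al0] the equation [FG] is known, and the chain of equalities is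
     read so as to yield the last one. *)
  move=> ta; have ta' := testfun1_derive1 ta.
  have tal : testfun1 al be a by exact: testfun1W ta.
  transitivity (\int[leb2]_z
      (W z * tensor a (fun y => r y * derive1 b y) z - G z * tensor a b z)).
    by apply: eq_Rintegral => z _; rewrite /Q /tensor; ring.
  rewrite RintegralB//.
  - apply/eqP; rewrite subr_eq0 -eqr_opp -(VW _ _ tal trb') -(FG _ _ ta tb).
    rewrite -rVF'//; apply/eqP; apply: eq_Rintegral => z _.
    by rewrite /tensor; ring.
  - exact: integrable_tensor_mul Wi ta trb'.
  - exact: integrable_tensor_mul Gi ta tb.
have PA : \int[leb2]_z (P z * derive1 A z.1) = 0.
  apply: (integral_mul_fst_eq0 Pi _ P0 (m _ _ _ _ tA') AC').
  by move=> z /out[F0 _ V0 _]; rewrite /P F0 V0 mulr0 !mul0r subr0.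
have QA : \int[leb2]_z (Q z * A z.1) = 0.
  apply: (integral_mul_fst_eq0 Qi _ Q0 (m _ _ _ _ tA) AC).
  by move=> z /out[_ G0 _ W0]; rewrite /Q G0 W0 !mul0r subr0.
have E1 : \int[leb2]_z (r z.2 * V z * tensor (derive1 A) (derive1 b) z) =
    \int[leb2]_z (F z * tensor (derive1 A) b z).
  apply/eqP; rewrite -subr_eq0 -RintegralB//.
  - by rewrite -[X in _ == X]PA; apply/eqP; apply: eq_Rintegral => z _; rewrite /P /tensor; ring.
  - exact: integrable_tensor_mul rVi tA' tb'.
  - exact: integrable_tensor_mul Fi tA' tb.
have E2 : \int[leb2]_z (W z * tensor A (fun y => r y * derive1 b y) z) =
    \int[leb2]_z (G z * tensor A b z).
  apply/eqP; rewrite -subr_eq0 -RintegralB//.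
  - by rewrite -[X in _ == X]QA; apply/eqP; apply: eq_Rintegral => z _; rewrite /Q /tensor; ring.
  - exact: integrable_tensor_mul Wi tA trb'.
  - exact: integrable_tensor_mul Gi tA tb.
rewrite -E2 -(VW _ _ tA trb') -E1; apply: eq_Rintegral => z _.
by rewrite /tensor; ring.
Qed.

End trace.

(** * Extension by zero and truncation *)

Section cutoffs.
Context {R : realType}.
Implicit Types (f g : R * R -> R) (a b : R -> R) (U : set (R * R)).
Variables (R0 theta0 : R).
Notation mu := (@lebesgue_measure R).
Notation leb2 := (mu \x mu)%E.
Notation Om := (Omega R0 theta0).

(** [loc_integrable] makes this integrable on the plane, and a test supported in R < M does not see
    the truncation. *)
Definition cutoff (M : R) f : R * R -> R := f \_ (Om `&` [set z | z.2 < M]).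

Lemma OmegaE : Om = `]0, theta0[ `*` `]R0, +oo[.
Proof.
by apply/seteqP; split => z; rewrite /Omega /= !in_itv/= ?andbT.
Qed.

Lemma measurable_Omega : measurable Om.
Proof. by rewrite OmegaE; apply: measurableX. Qed.

Lemma OmegaIE M : Om `&` [set z | z.2 < M] = `]0, theta0[ `*` `]R0, M[.
Proof.
apply/seteqP; split => z; rewrite /Omega /= !in_itv/=.
  by move=> [[-> ->] ->].
by move=> [-> /andP[-> ->]].
Qed.

Lemma measurable_OmegaI M : measurable (Om `&` [set z | z.2 < M]).
Proof. by rewrite OmegaIE; apply: measurableX. Qed.

Lemma cutoff_integrable M f : loc_integrable R0 theta0 f ->
  leb2.-integrable setT (EFin \o cutoff M f).
Proof.
move=> /(_ M) fM; rewrite /cutoff -restrict_EFin -integrable_mkcond//.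
exact: measurable_OmegaI.
Qed.

Lemma cutoff_out M f z : ~~ (0 < z.1 < theta0) -> cutoff M f z = 0.
Proof.
move=> h; rewrite /cutoff patchE; case: ifPn => //.
by rewrite inE /Omega/= => -[[zt _] _]; rewrite zt in h.
Qed.

Lemma integral_cutoff M f (phi : R * R -> R) : (forall z, M <= z.2 -> phi z = 0) ->
  (\int[leb2]_(z in Om) (f z * phi z)%:E = \int[leb2]_z (cutoff M f z * phi z)%:E)%E.
Proof.
move=> phi0; rewrite integral_mkcond; apply: eq_integral => z _.
rewrite /cutoff !patchE; have [zO|zO] := boolP (z \in Om).
  have [zM|Mz] := ltP z.2 M.
    rewrite mem_set//; split => //; exact: set_mem zO.
  by rewrite phi0// !mulr0.
rewrite memNset ?mul0r// => -[h _]; move: zO; rewrite notin_setE; exact.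
Qed.

Lemma tensor_eq0 (al M : R) a b (z : R * R) : testfun1 al M b -> M <= z.2 -> tensor a b z = 0.
Proof.
move=> [_ [p [q [_ qM bpq]]]] Mz; rewrite /tensor bpq ?mulr0//.
by rewrite negb_and -!ltNge (lt_le_trans qM Mz) orbT.
Qed.

(** With a negative [al], this turns a zero trace at omega = 0 into a weak equation for the
    extension by zero across that side. *)
Lemma weak_d_omega_tensor U f g (al be M : R) :
  weak_d_omega R0 theta0 U f g ->
  (forall z, al < z.1 < be -> R0 < z.2 -> U z) ->
  weak_tensor1 al be R0 M (cutoff M f) (cutoff M g).
Proof.
move=> [fi gi fg] hU A b tA tb.
have tU : test_function U (tensor A b).
  by apply: tensor_test_function tA tb _ => z zab /andP[zR _]; exact: hU.
have := fg _ tU; rewrite d_omega_tensor; last by case: tA.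
rewrite !(@integral_cutoff M)//; [|by move=> z; exact: tensor_eq0 tb..].
by move=> H; rewrite /Rintegral H fineN.
Qed.

Lemma weak_d_R_tensor f g (M : R) :
  weak_d_R R0 theta0 Om f g ->
  weak_tensor2 0 theta0 R0 M (cutoff M f) (cutoff M g).
Proof.
move=> [fi gi fg] A b tA tb.
have tU : test_function Om (tensor A b).
  by apply: tensor_test_function tA tb _ => z zab /andP[zR _]; split.
have := fg _ tU; rewrite d_R_tensor; last by case: tb.
rewrite !(@integral_cutoff M)//.
- by move=> H; rewrite /Rintegral H fineN.
- by move=> z; exact: tensor_eq0 tb.
- by move=> z; exact: tensor_eq0 (testfun1_derive1 tb).
Qed.

End cutoffs.

(** * Ladyzhenskaya's argument *)

Section ladyzhenskaya.
Context {R : realType}.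
Implicit Types (f g : R * R -> R) (k : R -> \bar R).
Notation mu := (@lebesgue_measure R).
Notation leb2 := (mu \x mu)%E.

Lemma ae_prod1 (P : R * R -> Prop) : measurable [set z | ~ P z] ->
  {ae mu, forall x, {ae mu, forall y, P (x, y)}} -> {ae leb2, forall z, P z}.
Proof.
move=> mP aeP; exists [set z | ~ P z]; split => //.
pose E : set (R * R) := [set z | ~ P z].
transitivity (\int[leb2]_z (\1_E z)%:E)%E.
  by rewrite integral_indic// setIT.
rewrite fubini_tonelli1//; last by apply/measurable_EFinP; exact: measurable_indic.
rewrite -(integral0 mu setT); apply: ae_eq_integral => //.
- apply: measurable_fun_fubini_tonelli_F => //.
  by apply/measurable_EFinP; exact: measurable_indic.
have := aeP; apply: filterS; first exact: (ae_filter_ringOfSetsType mu).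
move=> x Px _; rewrite -(integral0 mu setT); apply: ae_eq_integral => //.
- apply/measurable_EFinP.
  exact: (measurableT_comp (measurable_indic mP) (pair1_measurable x)).
- have := Px; apply: filterS; first exact: (ae_filter_ringOfSetsType mu).
  by move=> y Pxy _ /=; rewrite indicE memNset.
Qed.

Lemma ae_prod2 (P : R * R -> Prop) : measurable [set z | ~ P z] ->
  {ae mu, forall y, {ae mu, forall x, P (x, y)}} -> {ae leb2, forall z, P z}.
Proof.
move=> mP aeP; exists [set z | ~ P z]; split => //.
pose E : set (R * R) := [set z | ~ P z].
transitivity (\int[leb2]_z (\1_E z)%:E)%E.
  by rewrite integral_indic// setIT.
rewrite fubini_tonelli2//; last by apply/measurable_EFinP; exact: measurable_indic.
rewrite -(integral0 mu setT); apply: ae_eq_integral => //.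
- apply: measurable_fun_fubini_tonelli_G => //.
  by apply/measurable_EFinP; exact: measurable_indic.
have := aeP; apply: filterS; first exact: (ae_filter_ringOfSetsType mu).
move=> y Py _; rewrite -(integral0 mu setT); apply: ae_eq_integral => //.
- apply/measurable_EFinP.
  exact: (measurableT_comp (measurable_indic mP) (pair2_measurable y)).
- have := Py; apply: filterS; first exact: (ae_filter_ringOfSetsType mu).
  by move=> x Pxy _ /=; rewrite indicE memNset.
Qed.

Lemma ge0_integral_tensor k1 k2 :
  measurable_fun setT k1 -> measurable_fun setT k2 ->
  (forall x, 0 <= k1 x)%E -> (forall y, 0 <= k2 y)%E ->
  (\int[leb2]_z (k1 z.1 * k2 z.2) = \int[mu]_x k1 x * \int[mu]_y k2 y)%E.
Proof.
move=> m1 m2 k10 k20; rewrite fubini_tonelli1.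
- rewrite -ge0_integralZr//; last exact: integral_ge0.
  apply: eq_integral => x _; rewrite /fubini_F /=.
  by rewrite ge0_integralZl.
- apply: emeasurable_funM.
    exact: (measurableT_comp m1 measurable_fst).
  exact: (measurableT_comp m2 measurable_snd).
- by move=> z; rewrite mule_ge0.
Qed.

Lemma cauchy_schwarz_integral f g : measurable_fun setT f -> measurable_fun setT g ->
  (\int[leb2]_z (`|f z * g z|)%:E <=
    (\int[leb2]_z (f z ^+ 2)%:E) `^ 2^-1 * (\int[leb2]_z (g z ^+ 2)%:E) `^ 2^-1)%E.
Proof.
move=> mf mg.
have := @hoelder _ _ _ leb2 f g 2 2 mf mg (ltr0Sn _ 1) (ltr0Sn _ 1).
have -> : (2^-1 + 2^-1 = 1 :> R) by lra.
move=> /(_ erefl); rewrite Lnorm1 unlock.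
have sqrE (h : R * R -> R) : (fun z => `|(EFin \o h) z| `^ 2)%E = (fun z : R * R => (h z ^+ 2)%:E).
  by apply/funext => z; rewrite -[LHS]/((`|h z|%:E `^ 2)%E) poweR_EFin -[2]/(2%:R)
    powR_mulrn// real_normK ?num_real.
by rewrite !sqrE.
Qed.

(* Each of the two copies of [f^2] in [f^4] is bounded by an integral in one variable,
   hence [int f^4] by the product of the integrals of the bounds. *)
Lemma integral_exp4_le f (K1 : R -> \bar R) (K2 : R -> \bar R) (w : R -> R) :
  measurable_fun setT f -> measurable_fun setT w -> (forall y, 0 < w y) ->
  measurable_fun setT K1 -> measurable_fun setT K2 ->
  (forall x, 0 <= K1 x)%E -> (forall x, 0 <= K2 x)%E ->
  {ae leb2, forall z, (f z ^+ 2)%:E <= K1 z.2}%E ->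
  {ae leb2, forall z, (w z.2 * f z ^+ 2)%:E <= K2 z.1}%E ->
  (\int[leb2]_z (`|f z| ^+ 4)%:E <=
    \int[mu]_x K2 x * \int[mu]_y ((w y)^-1%:E * K1 y))%E.
Proof.
move=> mf mw w0 mK1 mK2 K10 K20 fK1 fK2.
have mwK : measurable_fun setT (fun y => (w y)^-1%:E * K1 y)%E.
  apply: emeasurable_funM => //; apply: measurableT_comp => //.
  rewrite (_ : (fun _ => _) = (fun x => w x `^ (-1))); last first.
    by apply/funext => x; rewrite powR_inv1// ltW.
  exact: (measurableT_comp (measurable_powR (-1)) mw).
have wK0 y : (0 <= (w y)^-1%:E * K1 y)%E.
  by rewrite mule_ge0// lee_fin invr_ge0 ltW.
rewrite -ge0_integral_tensor//.
apply: ae_ge0_le_integral => //.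
- by apply: measurableT_comp => //; apply: measurable_funX; exact: measurableT_comp.
- by move=> z _; rewrite mule_ge0.
- apply: emeasurable_funM.
    exact: (measurableT_comp mK2 measurable_fst).
  exact: (measurableT_comp mwK measurable_snd).
apply: filterS2 fK1 fK2; first exact: (ae_filter_ringOfSetsType leb2).
move=> z fK1 fK2 _.
have -> : (`|f z| ^+ 4)%:E = ((w z.2 * f z ^+ 2)%:E * ((w z.2)^-1%:E * (f z ^+ 2)%:E))%E.
  rewrite -!EFinM; congr EFin.
  rewrite -[4%N]/(2 * 2)%N exprM real_normK ?num_real//.
  by field; rewrite gt_eqF.
apply: lee_pmul => //.
- by rewrite lee_fin mulr_ge0 ?sqr_ge0// ltW.
- by rewrite -EFinM lee_fin mulr_ge0 ?sqr_ge0// invr_ge0 ltW.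
- by rewrite lee_wpmul2l// lee_fin invr_ge0 ltW.
Qed.

End ladyzhenskaya.

(** * Bounding the square by integrals along lines *)

Section pointwise_bounds.
Context {R : realType}.
Implicit Types (f g u v : R * R -> R) (x y : R).
Variables (R0 theta0 : R).
Notation mu := (@lebesgue_measure R).
Notation leb2 := (mu \x mu)%E.
Notation Om := (Omega R0 theta0).

Lemma nat_gt (x : R) : exists M : nat, x < M%:R.
Proof.
exists (Num.truncn `|x|).+1; apply: le_lt_trans (ler_norm x) _; exact: truncnS_gt.
Qed.

Lemma measurable_ext f : loc_integrable R0 theta0 f -> measurable_fun setT (f \_ Om).
Proof.
move=> fl; apply/(measurable_restrictT _ (measurable_Omega R0 theta0)).
have -> : Om = \bigcup_(n : nat) (Om `&` [set z | z.2 < n%:R]).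
  apply/seteqP; split => z; last by move=> [n _ []].
  by move=> zO; have [n zn] := nat_gt z.2; exists n.
apply/measurable_fun_bigcup => n; first exact: measurable_OmegaI.
by apply/measurable_EFinP; exact: measurable_int (fl n%:R).
Qed.

Lemma cutoff_ext M f x y : y < M -> cutoff R0 theta0 M f (x, y) = (f \_ Om) (x, y).
Proof.
move=> yM; rewrite /cutoff !patchE; have [zO|zO] := boolP ((x, y) \in Om).
  by rewrite mem_set//; split => //; exact: set_mem zO.
by rewrite memNset// => -[h _]; move: zO; rewrite notin_setE; exact.
Qed.

Lemma ext_out f x y : ~~ (0 < x < theta0) || ~~ (R0 < y) -> (f \_ Om) (x, y) = 0.
Proof.
move=> h; rewrite patchE memNset//= => -[/= xt yR].
by move: h; rewrite xt yR.
Qed.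

(** The extension by zero has a weak derivative on ]-1, theta0[ and vanishes on ]-1, 0[, so
    [ae_sqr_le_of_zero] applies on almost every line; the number -1 only has to be negative. *)
Lemma ae_sqr_le_integral_omega f g : 0 < theta0 ->
  loc_integrable R0 theta0 f -> loc_integrable R0 theta0 g ->
  (forall M, weak_tensor1 (-1) theta0 R0 M (cutoff R0 theta0 M f) (cutoff R0 theta0 M g)) ->
  {ae mu, forall y, {ae mu, forall x,
    (((f \_ Om) (x, y) ^+ 2)%:E <=
     2%:E * \int[mu]_s `|(f \_ Om) (s, y) * (g \_ Om) (s, y)|%:E)%E}}.
Proof.
move=> t0 fl gl fg.
have fi M := cutoff_integrable M fl; have gi M := cutoff_integrable M gl.
have H (M : nat) : {ae mu, forall y, R0 < y < M%:R -> {ae mu, forall x, 0 < x < theta0 ->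
    ((cutoff R0 theta0 M%:R f (x, y) ^+ 2)%:E <=
     2%:E * \int[mu]_s `|cutoff R0 theta0 M%:R f (s, y) * cutoff R0 theta0 M%:R g (s, y)|%:E)%E}}.
  have H1 := ae_slice2_prim (lt_trans (ltrN10 _) t0) (fi M%:R) (gi M%:R) (fg M%:R).
  apply: filterS3 H1 (ae_integrable2 (fi M%:R)) (ae_integrable2 (gi M%:R)).
    exact: (ae_filter_ringOfSetsType mu).
  move=> y H1 fy gy yM; have [c cF] := H1 yM.
  apply: (@ae_sqr_le_of_zero _ (fun s => cutoff R0 theta0 M%:R f (s, y))
    (fun s => cutoff R0 theta0 M%:R g (s, y)) c (-1) 0 theta0) => //.
  - by apply/measurable_EFinP; exact: measurable_int fy.
  - by move=> t /andP[_ t0']; rewrite cutoff_out//= negb_and -leNgt (ltW t0').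
have := ae_foralln H; apply: filterS => y Hy.
have [yR|Ry] := leP y R0.
  apply: aeW => x; rewrite ext_out -?leNgt ?yR ?orbT// expr0n/=.
  by rewrite mule_ge0// integral_ge0.
(* Below the level [M] the truncated functions agree with the full extensions on the entire
   horizontal line. *)
have [M yM] := nat_gt y.
have := Hy M; rewrite Ry yM => /(_ isT); apply: filterS.
  exact: (ae_filter_ringOfSetsType mu).
move=> x Hx; have [xt|xt] := boolP (0 < x < theta0); last first.
  rewrite ext_out ?xt// expr0n/= mule_ge0// integral_ge0//.
move: (Hx xt); rewrite cutoff_ext//; congr (_ <= _ * _)%E.
by apply: eq_integral => s _; rewrite !cutoff_ext.
Qed.

(** Fubini turns the finite weighted integral on the plane into the finite integrals on lines that
    [ae_sqr_le_decay] uses in place of a condition at infinity. *)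
Lemma ae_sqr_le_integral_R f g (w : R -> R) : 0 < theta0 ->
  loc_integrable R0 theta0 f -> loc_integrable R0 theta0 g ->
  (forall M, weak_tensor2 0 theta0 R0 M (cutoff R0 theta0 M f) (cutoff R0 theta0 M g)) ->
  measurable_fun setT w -> (forall y, 0 <= w y) -> {homo w : x y / x <= y} ->
  (\int[leb2]_z (w z.2 * (f \_ Om) z ^+ 2)%:E < +oo)%E ->
  {ae mu, forall x, {ae mu, forall y,
    ((w y * (f \_ Om) (x, y) ^+ 2)%:E <=
     2%:E * \int[mu]_t (w t * `|(f \_ Om) (x, t) * (g \_ Om) (x, t)|)%:E)%E}}.
Proof.
move=> t0 fl gl fg mw w0 wmono fin.
have fi M := cutoff_integrable M fl; have gi M := cutoff_integrable M gl.
have mf := measurable_ext fl; have mg := measurable_ext gl.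
have wfi : leb2.-integrable setT (EFin \o (fun z => w z.2 * (f \_ Om) z ^+ 2)).
  apply/integrableP; split.
    apply/measurable_EFinP; apply: measurable_funM; last exact: measurable_funX.
    exact: (measurableT_comp mw measurable_snd).
  apply: le_lt_trans fin; rewrite le_eqVlt; apply/orP; left; apply/eqP.
  by apply: eq_integral => z _; rewrite /= ger0_norm// mulr_ge0 ?sqr_ge0.
have /ae_foralln H1 : forall M : nat, {ae mu, forall x, 0 < x < theta0 -> exists c,
    {ae mu, forall y, R0 < y < M%:R ->
      cutoff R0 theta0 M%:R f (x, y) = c + prim (fun s => cutoff R0 theta0 M%:R g (x, s)) y}}.
  move=> M; have [RM|MR] := ltP R0 M%:R.
    exact: ae_slice1_prim.
  apply: aeW => x _; exists 0; apply: aeW => y /andP[Ry yM].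
  by move: (lt_trans Ry yM); rewrite ltNge MR.
have /ae_foralln H2 : forall M : nat, {ae mu, forall x,
    mu.-integrable setT (fun y => (EFin \o cutoff R0 theta0 M%:R g) (x, y))}.
  by move=> M; exact: ae_integrable1.
have H3 := ae_integrable1 wfi.
apply: filterS3 H1 H2 H3 => x H1 H2 H3.
have [xt|xt] := boolP (0 < x < theta0); last first.
  apply: aeW => y; rewrite ext_out ?xt// expr0n/= mulr0 mule_ge0// integral_ge0// => t _.
  by rewrite lee_fin mulr_ge0.
have cutoffE h (M : nat) : (fun y => cutoff R0 theta0 M%:R h (x, y)) =
    (fun y => (h \_ Om) (x, y)) \_ `]R0, M%:R[.
  apply/funext => y; rewrite [RHS]patchE mem_setE in_itv/=.
  have [/andP[Ry yM]|yRM] := boolP (R0 < y < M%:R); first by rewrite cutoff_ext.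
  rewrite /cutoff patchE memNset// => -[[_ /= Ry] yM]; move: yRM.
  by rewrite Ry yM.
have mfx : measurable_fun setT (fun y => (f \_ Om) (x, y)).
  exact: (measurableT_comp mf (pair1_measurable x)).
have mgx : measurable_fun setT (fun y => (g \_ Om) (x, y)).
  exact: (measurableT_comp mg (pair1_measurable x)).
have mwfg : measurable_fun setT
    (fun t => (w t * `|(f \_ Om) (x, t) * (g \_ Om) (x, t)|)%:E).
  apply: measurableT_comp => //; apply: measurable_funM => //.
  by apply: measurableT_comp => //; exact: measurable_funM.
have : {ae mu, forall y, R0 < y -> ((w y * (f \_ Om) (x, y) ^+ 2)%:E <=
     2%:E * \int[mu]_(t in `]R0, +oo[) (w t * `|(f \_ Om) (x, t) * (g \_ Om) (x, t)|)%:E)%E}.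
  apply: (ae_sqr_le_decay mfx mgx mw w0).
  - by move=> a b _; exact: wmono.
  - by move=> M; rewrite -cutoffE; exact: H2.
  - move=> M; have [c cF] := H1 M xt; exists c; rewrite -cutoffE.
    have := cF; apply: filterS; first exact: (ae_filter_ringOfSetsType mu).
    by move=> y h yM; rewrite -h// cutoff_ext//; case/andP: yM.
  - case/integrableP : H3 => mH; apply: le_lt_trans.
    rewrite (_ : (\int[mu]_x0 _)%E = (\int[mu]_y (w y * (f \_ Om) (x, y) ^+ 2)%:E)%E); last first.
      by apply: eq_integral => y _; rewrite /= ger0_norm// mulr_ge0 ?sqr_ge0.
    apply: ge0_subset_integral => //.
    by move=> y _; rewrite lee_fin mulr_ge0 ?sqr_ge0.
apply: filterS; first exact: (ae_filter_ringOfSetsType mu).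
move=> y Hy; have [yR|Ry] := leP y R0.
  rewrite ext_out -?leNgt ?yR ?orbT// expr0n/= mulr0 mule_ge0// integral_ge0// => t _.
  by rewrite lee_fin mulr_ge0.
apply: le_trans (Hy Ry) _; rewrite lee_pmul2l//.
apply: ge0_subset_integral => // t _.
by rewrite lee_fin mulr_ge0.
Qed.

End pointwise_bounds.

(** * Weights and norms *)

Section scaled_radius.
Context {R : realType}.
Implicit Types (f g u v : R * R -> R) (x y : R).
Variables (R0 theta0 eps delta : R).
Hypothesis R0_gt0 : 0 < R0.
Hypothesis delta_itv : 2^-1 <= delta <= 1.
Notation mu := (@lebesgue_measure R).
Notation leb2 := (mu \x mu)%E.
Notation Om := (Omega R0 theta0).
Notation r := (rscaled R0 eps).

(* The scaled radius, truncated below so as to be positive on the whole line. *)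
Definition radiusR y : R := Num.max R0 (R0 + Num.sqrt eps * (y - R0)).

Lemma radiusR_ge y : R0 <= radiusR y.
Proof. by rewrite le_max lexx. Qed.

Lemma radiusR_gt0 y : 0 < radiusR y.
Proof. exact: lt_le_trans (radiusR_ge y). Qed.

Lemma radiusRE z : Om z -> rscaled R0 eps z = radiusR z.2.
Proof.
move=> [_ zR]; rewrite /radiusR /rscaled; apply/esym/max_idPr.
by rewrite lerDl mulr_ge0 ?sqrtr_ge0// subr_ge0 ltW.
Qed.

Lemma le_radiusR : {homo radiusR : x y / x <= y}.
Proof.
move=> x y xy; rewrite /radiusR ge_max le_max lexx/= le_max; apply/orP; right.
by rewrite lerD2l ler_wpM2l ?sqrtr_ge0// lerB.
Qed.

Lemma measurable_affine_radius :
  measurable_fun setT (fun y : R => R0 + Num.sqrt eps * (y - R0)).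
Proof.
by apply: measurable_funD => //; apply: measurable_funM => //; exact: measurable_funB.
Qed.

Lemma measurable_radiusR : measurable_fun setT radiusR.
Proof. by apply: measurable_maxr => //; exact: measurable_affine_radius. Qed.

Lemma smooth_affine_radius : smooth (fun y : R => R0 + Num.sqrt eps * (y - R0)).
Proof.
move=> n; apply: diffnD; first exact: diffn_cst.
apply: diffnM; first exact: diffn_cst.
by apply: diffnD; [exact: diffn_id|exact: diffn_cst].
Qed.

Lemma measurable_radiusR_powR (s : R) :
  measurable_fun setT (fun z : R * R => radiusR z.2 `^ s).
Proof.
have mr : measurable_fun setT (fun y => radiusR y `^ s).
  exact: (measurableT_comp (measurable_powR s) measurable_radiusR).
exact: (measurableT_comp mr measurable_snd).
Qed.

(** [weak_tensor1_trace] with [V] the cutoff of [v], whose zero trace gives the equation across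
    omega = 0. The multiplier is the affine radius and not [radiusR], because it has to be
    smooth. *)
Lemma weak_tensor1_of_divergence_free (uw uww v : R * R -> R) M :
  weak_d_omega R0 theta0 Om uw uww ->
  weak_d_R R0 theta0 Om (fun z => r z * v z) (fun z => - uw z) ->
  zero_at_omega0 R0 theta0 v ->
  weak_tensor1 (-1) theta0 R0 M (cutoff R0 theta0 M uw) (cutoff R0 theta0 M uww).
Proof.
move=> hww hdiv [gv hv].
have [uwl uwwl _] := hww; have [vl gvl _] := hv; have [rvl _ _] := hdiv.
have rvE : cutoff R0 theta0 M (fun z => r z * v z) =
    (fun z => (R0 + Num.sqrt eps * (z.2 - R0)) * cutoff R0 theta0 M v z).
  by apply/funext => z; rewrite /cutoff !patchE; case: ifP => _; rewrite ?mulr0.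
apply: (@weak_tensor1_trace _ (-1) 0 theta0 R0 M _ _ (cutoff R0 theta0 M v)
  (cutoff R0 theta0 M gv) (fun y => R0 + Num.sqrt eps * (y - R0))).
- exact: lerN10.
- exact: cutoff_integrable.
- exact: cutoff_integrable.
- exact: cutoff_integrable.
- exact: cutoff_integrable.
- by rewrite -rvE; exact: cutoff_integrable.
- exact: smooth_affine_radius.
- by move=> z h; rewrite !cutoff_out.
- have := @weak_d_R_tensor _ _ _ _ _ M hdiv; rewrite rvE; congr weak_tensor2.
  by apply/funext => z; rewrite /cutoff !patchE; case: ifP => _; rewrite ?oppr0.
- apply: weak_d_omega_tensor hv _ => z /andP[_ zt] zR.
  by split.
- apply: weak_d_omega_tensor hww _ => z zt zR.
  by split.
Qed.

Lemma powR_radiusR_le y :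
  radiusR y `^ (1 - delta) <= R0 `^ (1 - 2 * delta) * radiusR y `^ delta.
Proof.
have /andP[d1 _] := delta_itv.
have -> : 1 - delta = (1 - 2 * delta) + delta by ring.
rewrite powRD; last by rewrite (gt_eqF (radiusR_gt0 y)) implybT.
rewrite ler_wpM2r ?powR_ge0//.
have -> : 1 - 2 * delta = - (2 * delta - 1) by ring.
rewrite !powRN lef_pV2 ?posrE ?powR_gt0 ?radiusR_gt0//.
apply: ge0_ler_powR; rewrite ?nnegrE ?(ltW R0_gt0) ?(ltW (radiusR_gt0 y)) ?radiusR_ge//.
by lra.
Qed.

Lemma measurable_on_Omega f : loc_integrable R0 theta0 f -> measurable_fun Om f.
Proof.
by move=> /measurable_ext/(measurable_restrictT _ (measurable_Omega R0 theta0)).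
Qed.

(** Common form of the three norm comparisons below: one term of the integrand of a norm is written
    as a perfect square, ready for Cauchy-Schwarz. *)
Lemma poweR_integral_le f (N : R * R -> R) (s : R) :
  loc_integrable R0 theta0 f -> measurable_fun Om N ->
  (forall z, Om z -> (radiusR z.2 `^ s * f z) ^+ 2 <= N z) ->
  ((\int[leb2]_z ((radiusR z.2 `^ s * (f \_ Om) z) ^+ 2)%:E) `^ 2^-1 <=
    (\int[leb2]_(z in Om) (N z)%:E) `^ 2^-1)%E.
Proof.
move=> fl mN fN.
have N0 z : Om z -> 0 <= N z by move=> /fN; apply: le_trans; exact: sqr_ge0.
apply: gt0_ler_poweR; rewrite ?in_itv/= ?andbT ?invr_ge0//.
- by rewrite leey andbT integral_ge0// => z _; rewrite lee_fin sqr_ge0.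
- by rewrite leey andbT integral_ge0// => z zO; rewrite lee_fin N0.
rewrite [leRHS]integral_mkcond restrict_EFin; apply: ge0_le_integral => //.
- by move=> z _; rewrite lee_fin sqr_ge0.
- apply/measurable_EFinP/measurable_funX; apply: measurable_funM.
    exact: measurable_radiusR_powR.
  exact: measurable_ext.
- apply/measurable_EFinP.
  exact/(measurable_restrictT _ (measurable_Omega R0 theta0)).
- move=> z _; rewrite lee_fin !patchE; case: ifPn => [/set_mem/fN//|_].
  by rewrite mulr0 expr0n.
Qed.

Lemma rscaled_gt0 z : Om z -> 0 < r z.
Proof. by move=> /radiusRE ->; exact: radiusR_gt0. Qed.

Lemma measurable_rscaled : measurable_fun setT r.
Proof. exact: (measurableT_comp measurable_affine_radius measurable_snd). Qed.

Lemma measurable_rscaled_powR (s : R) : measurable_fun Om (fun z => r z `^ s).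
Proof.
apply: measurable_funTS; exact: (measurableT_comp (measurable_powR s) measurable_rscaled).
Qed.

Lemma norm_X_ge (u uw uR : R * R -> R) :
  loc_integrable R0 theta0 u -> loc_integrable R0 theta0 uw ->
  loc_integrable R0 theta0 uR ->
  ((\int[leb2]_z ((radiusR z.2 `^ (delta / 2) * (uw \_ Om) z) ^+ 2)%:E) `^ 2^-1 <=
    norm_X R0 theta0 eps delta u uw uR)%E.
Proof.
move=> /measurable_on_Omega mu_ uwl /measurable_on_Omega muR.
have muw := measurable_on_Omega uwl.
apply: poweR_integral_le => //.
  by do 2?apply: measurable_funD; apply: measurable_funM => //;
    (exact: measurable_funX || exact: measurable_rscaled_powR).
move=> z zO; rewrite -radiusRE//.
have -> : (r z `^ (delta / 2) * uw z) ^+ 2 = uw z ^+ 2 * r z `^ delta.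
  by rewrite exprMn -(powR_mulrn 2 (powR_ge0 _ _)) -powRrM divfK// mulrC.
by rewrite -addrA addrCA lerDl addr_ge0// mulr_ge0 ?sqr_ge0 ?powR_ge0.
Qed.

Lemma measurable_norm_H2 (uww uwR uRR : R * R -> R) :
  loc_integrable R0 theta0 uww -> loc_integrable R0 theta0 uwR ->
  loc_integrable R0 theta0 uRR ->
  measurable_fun Om (fun z => (uww z ^+ 2 / r z ^+ 4 + uwR z ^+ 2 / r z ^+ 2
       + uRR z ^+ 2) * r z `^ (2 + delta)).
Proof.
move=> /measurable_on_Omega mww /measurable_on_Omega mwR /measurable_on_Omega mRR.
have mrV n : measurable_fun Om (fun z => (r z ^+ n)^-1).
  apply: (eq_measurable_fun (fun z => r z `^ (- n%:R))); last exact: measurable_rscaled_powR.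
  by move=> z /set_mem zO; rewrite powR_invn// ltW// rscaled_gt0.
apply: measurable_funM; last exact: measurable_rscaled_powR.
do 2?apply: measurable_funD; last exact: measurable_funX.
- by apply: measurable_funM => //; exact: measurable_funX.
- by apply: measurable_funM => //; exact: measurable_funX.
Qed.

Lemma norm_H2_ge_ww (uww uwR uRR : R * R -> R) :
  loc_integrable R0 theta0 uww -> loc_integrable R0 theta0 uwR ->
  loc_integrable R0 theta0 uRR ->
  ((\int[leb2]_z ((radiusR z.2 `^ (delta / 2 - 1) * (uww \_ Om) z) ^+ 2)%:E) `^ 2^-1 <=
    norm_H2 R0 theta0 eps delta uww uwR uRR)%E.
Proof.
move=> mww mwR mRR; apply: poweR_integral_le => //; first exact: measurable_norm_H2.
move=> z zO; have r0 := rscaled_gt0 zO; rewrite -radiusRE//.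
have -> : (r z `^ (delta / 2 - 1) * uww z) ^+ 2 = uww z ^+ 2 / r z ^+ 4 * r z `^ (2 + delta).
  rewrite exprMn -(powR_mulrn 2 (powR_ge0 _ _)) -powRrM.
  have -> : (delta / 2 - 1) * 2%:R = - 4%:R + (2 + delta) by field.
  by rewrite powRD ?(gt_eqF r0) ?implybT// powR_invn ?(ltW r0)//; ring.
rewrite ler_wpM2r ?powR_ge0// -addrA lerDl addr_ge0 ?sqr_ge0//.
by rewrite divr_ge0 ?sqr_ge0.
Qed.

Lemma norm_H2_ge_wR (uww uwR uRR : R * R -> R) :
  loc_integrable R0 theta0 uww -> loc_integrable R0 theta0 uwR ->
  loc_integrable R0 theta0 uRR ->
  ((\int[leb2]_z ((radiusR z.2 `^ (delta / 2) * (uwR \_ Om) z) ^+ 2)%:E) `^ 2^-1 <=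
    norm_H2 R0 theta0 eps delta uww uwR uRR)%E.
Proof.
move=> mww mwR mRR; apply: poweR_integral_le => //; first exact: measurable_norm_H2.
move=> z zO; have r0 := rscaled_gt0 zO; rewrite -radiusRE//.
have -> : (r z `^ (delta / 2) * uwR z) ^+ 2 = uwR z ^+ 2 / r z ^+ 2 * r z `^ (2 + delta).
  rewrite exprMn -(powR_mulrn 2 (powR_ge0 _ _)) -powRrM.
  have -> : (delta / 2) * 2%:R = - 2%:R + (2 + delta) by field.
  by rewrite powRD ?(gt_eqF r0) ?implybT// powR_invn ?(ltW r0)//; ring.
rewrite ler_wpM2r ?powR_ge0// addrAC lerDr addr_ge0 ?sqr_ge0//.
by rewrite divr_ge0 ?sqr_ge0// exprn_ge0// ltW.
Qed.

End scaled_radius.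

(** * The estimate with its explicit constant *)

Section main_estimate.
Context {R : realType}.
Variables (R0 theta0 delta : R).
Hypotheses (R0_gt0 : 0 < R0) (theta0_gt0 : 0 < theta0).
Hypothesis delta_itv : 2^-1 <= delta <= 1.
Notation mu := (@lebesgue_measure R).
Notation leb2 := (mu \x mu)%E.
Notation Om := (Omega R0 theta0).

(** The first weak hypothesis, on ]-1, theta0[, contains the zero trace at omega = 0. In the
    constant, 4 is the product of the factors 2 of the two bounds on lines, the power of [R0] comes
    from [powR_radiusR_le], and the exponent from the fourth root. *)
Lemma norm_L4_le_of_weak_tensor (eps : R) (u uw uR uww uwR uRR : R * R -> R) :
  loc_integrable R0 theta0 u -> loc_integrable R0 theta0 uw ->
  loc_integrable R0 theta0 uR -> loc_integrable R0 theta0 uww ->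
  loc_integrable R0 theta0 uwR -> loc_integrable R0 theta0 uRR ->
  (forall M, weak_tensor1 (-1) theta0 R0 M (cutoff R0 theta0 M uw) (cutoff R0 theta0 M uww)) ->
  (forall M, weak_tensor2 0 theta0 R0 M (cutoff R0 theta0 M uw) (cutoff R0 theta0 M uwR)) ->
  (norm_X R0 theta0 eps delta u uw uR < +oo)%E ->
  (norm_H2 R0 theta0 eps delta uww uwR uRR < +oo)%E ->
  (norm_L4 R0 theta0 uw <=
     ((4 * R0 `^ (1 - 2 * delta)) `^ 4^-1)%:E *
       norm_X R0 theta0 eps delta u uw uR `^ 2^-1
       * norm_H2 R0 theta0 eps delta uww uwR uRR `^ 2^-1)%E.
Proof.
move=> ul uwl uRl uwwl uwRl uRRl weak1 weak2.
set nX := norm_X _ _ _ _ _ _ _; set nH := norm_H2 _ _ _ _ _ _ _ => nXoo nHoo.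
set D := R0 `^ (1 - 2 * delta).
have D0 : 0 < D by rewrite powR_gt0.
pose F := uw \_ Om; pose G1 := uww \_ Om; pose G2 := uwR \_ Om.
have mF : measurable_fun setT F := measurable_ext uwl.
have mG1 : measurable_fun setT G1 := measurable_ext uwwl.
have mG2 : measurable_fun setT G2 := measurable_ext uwRl.
pose rad := radiusR R0 eps.
have rad0 y : 0 < rad y by exact: radiusR_gt0.
pose w y := rad y `^ (1 - delta).
have w0 y : 0 < w y by rewrite powR_gt0.
have mw : measurable_fun setT w.
  exact: (measurableT_comp (measurable_powR (1 - delta)) (@measurable_radiusR R R0 eps)).
have mrad s : measurable_fun setT (fun z : R * R => rad z.2 `^ s).
  exact: measurable_radiusR_powR.
have mradM t h : measurable_fun setT h ->
    measurable_fun setT (fun z : R * R => rad z.2 `^ t * h z).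
  by move=> mh; apply: measurable_funM => //; exact: mrad.
have XF := norm_X_ge eps delta ul uwl uRl.
have HG1 := norm_H2_ge_ww eps delta R0_gt0 uwwl uwRl uRRl.
have HG2 := norm_H2_ge_wR eps delta R0_gt0 uwwl uwRl uRRl.
rewrite -/nX -/F in XF; rewrite -/nH -/G1 in HG1; rewrite -/nH -/G2 in HG2.
have wD y : w y <= D * (rad y `^ (delta / 2) * rad y `^ (delta / 2)).
  have -> : rad y `^ (delta / 2) * rad y `^ (delta / 2) = rad y `^ delta.
    by rewrite -powRD ?(gt_eqF (rad0 y)) ?implybT// -splitr.
  exact: powR_radiusR_le.
(* This finiteness replaces decay at infinity; it follows from the X norm because [w] is at most [D]
   times the weight r^delta. *)
have wfin : (\int[leb2]_z (w z.2 * F z ^+ 2)%:E < +oo)%E.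
  have XFoo : (\int[leb2]_z ((rad z.2 `^ (delta / 2) * F z) ^+ 2)%:E < +oo)%E.
    apply: (@lty_poweRy _ _ 2^-1); first by rewrite invr_eq0.
    exact: le_lt_trans XF nXoo.
  apply: (@le_lt_trans _ _ (D%:E * \int[leb2]_z ((rad z.2 `^ (delta / 2) * F z) ^+ 2)%:E)%E).
    rewrite -ge0_integralZl//; last 3 first.
    - by apply/measurable_EFinP/measurable_funX; exact: mradM.
    - by move=> z _; rewrite lee_fin sqr_ge0.
    - by rewrite lee_fin ltW.
    apply: ge0_le_integral => //.
    - by move=> z _; rewrite lee_fin mulr_ge0 ?sqr_ge0// ltW.
    - apply/measurable_EFinP; apply: measurable_funM; last exact: measurable_funX.
      exact: (measurableT_comp mw measurable_snd).
    - apply: measurable_funeM.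
      by apply/measurable_EFinP/measurable_funX; exact: mradM.
    - move=> z _; rewrite -EFinM lee_fin.
      apply: le_trans (ler_wpM2r (sqr_ge0 (F z)) (wD z.2)) _.
      by rewrite le_eqVlt; apply/orP; left; apply/eqP; ring.
  by rewrite lte_mul_pinfty// ?lee_fin ?ltW.
have B1 := ae_sqr_le_integral_omega theta0_gt0 uwl uwwl weak1.
(* The upper bound [delta <= 1] makes the exponent of the weight nonnegative. *)
have wmono : {homo w : x y / x <= y}.
  have /andP[_ d1] := delta_itv.
  move=> x y xy; apply: ge0_ler_powR; rewrite ?subr_ge0// ?nnegrE ?(ltW (rad0 _))//.
  exact: le_radiusR.
have B2 := ae_sqr_le_integral_R theta0_gt0 uwl uwRl weak2 mw (fun y => ltW (w0 y)) wmono wfin.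
have mFG1 : measurable_fun setT (fun z => `|F z * G1 z|%:E).
  by do 2 apply: measurableT_comp => //; exact: measurable_funM.
have mwFG2 : measurable_fun setT (fun z => (w z.2 * `|F z * G2 z|)%:E).
  apply: measurableT_comp => //; apply: measurable_funM.
    exact: (measurableT_comp mw measurable_snd).
  by apply: measurableT_comp => //; exact: measurable_funM.
have wFG20 z : (0 <= (w z.2 * `|F z * G2 z|)%:E)%E.
  by rewrite lee_fin mulr_ge0// ltW.
pose k1 y := (\int[mu]_s `|F (s, y) * G1 (s, y)|%:E)%E.
pose k2 x := (\int[mu]_t (w t * `|F (x, t) * G2 (x, t)|)%:E)%E.
have mk1 : measurable_fun setT k1.
  apply: (@measurable_fun_fubini_tonelli_G _ _ _ _ _ mu (fun z => `|F z * G1 z|%:E)) => //.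
have mk2 : measurable_fun setT k2.
  exact: (@measurable_fun_fubini_tonelli_F _ _ _ _ _ mu (fun z => (w z.2 * `|F z * G2 z|)%:E)).
have k10 y : (0 <= k1 y)%E by exact: integral_ge0.
have k20 x : (0 <= k2 x)%E by apply: integral_ge0 => t _; exact: (wFG20 (x, t)).
have I4 : (\int[leb2]_z (`|F z| ^+ 4)%:E <=
    \int[mu]_x (2%:E * k2 x) * \int[mu]_y ((w y)^-1%:E * (2%:E * k1 y)))%E.
  apply: integral_exp4_le => //.
  - exact: measurable_funeM.
  - exact: measurable_funeM.
  - by move=> y; rewrite mule_ge0.
  - by move=> x; rewrite mule_ge0.
  - apply: ae_prod2; last exact: B1.
    rewrite [X in measurable X](_ : _ =
      ~` (setT `&` [set z | ((F z ^+ 2)%:E <= 2%:E * k1 z.2)%E])); last first.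
      by rewrite setTI; apply/seteqP; split.
    apply: measurableC; apply: emeasurable_fun_le => //.
    + by apply/measurable_EFinP; exact: measurable_funX.
    + by apply: measurable_funeM; exact: (measurableT_comp mk1 measurable_snd).
  - apply: ae_prod1; last exact: B2.
    rewrite [X in measurable X](_ : _ =
      ~` (setT `&` [set z | ((w z.2 * F z ^+ 2)%:E <= 2%:E * k2 z.1)%E])); last first.
      by rewrite setTI; apply/seteqP; split.
    apply: measurableC; apply: emeasurable_fun_le => //.
    + apply/measurable_EFinP; apply: measurable_funM; last exact: measurable_funX.
      exact: (measurableT_comp mw measurable_snd).
    + by apply: measurable_funeM; exact: (measurableT_comp mk2 measurable_fst).
have K2le : (\int[mu]_x k2 x <= D%:E * (nX * nH))%E.
  have -> : (\int[mu]_x k2 x = \int[leb2]_z (w z.2 * `|F z * G2 z|)%:E)%E.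
    by rewrite fubini_tonelli1.
  apply: (@le_trans _ _ (D%:E * \int[leb2]_z
      `|(rad z.2 `^ (delta / 2) * F z) * (rad z.2 `^ (delta / 2) * G2 z)|%:E)%E).
    rewrite -ge0_integralZl//; last 2 first.
    - by do 2 apply: measurableT_comp => //; apply: measurable_funM; exact: mradM.
    - by rewrite lee_fin ltW.
    apply: ge0_le_integral => //.
    - apply: measurable_funeM; do 2 apply: measurableT_comp => //.
      by apply: measurable_funM; exact: mradM.
    - move=> z _; rewrite -EFinM lee_fin.
      apply: le_trans (ler_wpM2r (normr_ge0 (F z * G2 z)) (wD z.2)) _.
      by rewrite le_eqVlt; apply/orP; left; apply/eqP;
        rewrite !normrM !(ger0_norm (powR_ge0 _ _)); ring.
  rewrite lee_wpmul2l ?lee_fin ?(ltW D0)//.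
  apply: le_trans (cauchy_schwarz_integral (mradM _ _ mF) (mradM _ _ mG2)) _.
  by apply: lee_pmul => //; exact: poweR_ge0.
(* The exponent [delta - 1] is split so that one factor is the weight of u_omega in the X norm and
   the other that of the second omega-derivative in the H2 norm. *)
have wV y : (w y)^-1 = rad y `^ (delta / 2) * rad y `^ (delta / 2 - 1).
  rewrite -powRN -powRD ?(gt_eqF (rad0 y)) ?implybT//; congr (_ `^ _); by field.
have K1le : (\int[mu]_y ((w y)^-1%:E * k1 y) <= nX * nH)%E.
  have -> : (\int[mu]_y ((w y)^-1%:E * k1 y) = \int[leb2]_z
      `|(rad z.2 `^ (delta / 2) * F z) * (rad z.2 `^ (delta / 2 - 1) * G1 z)|%:E)%E.
    rewrite fubini_tonelli2//; last first.
      by do 2 apply: measurableT_comp => //; apply: measurable_funM; exact: mradM.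
    apply: eq_integral => y _; rewrite /k1 -ge0_integralZl//.
    - apply: eq_integral => s _; rewrite -EFinM wV /= !normrM !(ger0_norm (powR_ge0 _ _)).
      by congr EFin; ring.
    - by exact: (measurableT_comp mFG1 (pair2_measurable y)).
    - by rewrite lee_fin invr_ge0 ltW.
  apply: le_trans (cauchy_schwarz_integral (mradM _ _ mF) (mradM _ _ mG1)) _.
  by apply: lee_pmul => //; exact: poweR_ge0.
have nX0 : (0 <= nX)%E by exact: poweR_ge0.
have nH0 : (0 <= nH)%E by exact: poweR_ge0.
have wK1 : (\int[mu]_y ((w y)^-1%:E * (2%:E * k1 y)) =
    2%:E * \int[mu]_y ((w y)^-1%:E * k1 y))%E.
  rewrite -ge0_integralZl//.
  - by apply: eq_integral => y _; rewrite muleCA.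
  - apply: emeasurable_funM => //; apply/measurable_EFinP.
    rewrite (_ : (fun _ => _) = (fun x => w x `^ (-1))); last first.
      by apply/funext => x; rewrite powR_inv1// ltW.
    exact: (measurableT_comp (measurable_powR (-1)) mw).
  - by move=> y _; rewrite mule_ge0// lee_fin invr_ge0 ltW.
have {I4} : (\int[leb2]_z (`|F z| ^+ 4)%:E <=
    (2%:E * (D%:E * (nX * nH))) * (2%:E * (nX * nH)))%E.
  apply: le_trans I4 _; rewrite ge0_integralZl// wK1.
  apply: lee_pmul.
  - by rewrite mule_ge0// integral_ge0.
  - rewrite mule_ge0// integral_ge0// => y _.
    by rewrite mule_ge0// lee_fin invr_ge0 ltW.
  - by rewrite lee_wpmul2l.
  - by rewrite lee_wpmul2l.
(* Both norms being finite, the rest is a computation with real numbers x and h: the fourth root of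
   x^2 h^2 is x^(1/2) h^(1/2). *)
have nXE : nX = (fine nX)%:E by rewrite fineK// ge0_fin_numE.
have nHE : nH = (fine nH)%:E by rewrite fineK// ge0_fin_numE.
have x0 : 0 <= fine nX by exact: fine_ge0.
have h0 : 0 <= fine nH by exact: fine_ge0.
rewrite nXE nHE; move: (fine nX) (fine nH) x0 h0 => x h x0 h0.
rewrite -!EFinM => I4.
rewrite /norm_L4.
have -> : (\int[leb2]_(z in Om) (`|uw z| ^+ 4)%:E = \int[leb2]_z (`|F z| ^+ 4)%:E)%E.
  rewrite integral_mkcond; apply: eq_integral => z _.
  by rewrite /F !patchE; case: ifP => //; rewrite normr0 expr0n.
apply: (@le_trans _ _ ((4 * D * (x ^+ 2 * h ^+ 2))%:E `^ 4^-1)%E).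
  apply: gt0_ler_poweR; rewrite ?in_itv/= ?andbT ?invr_ge0//.
  - by rewrite leey andbT integral_ge0// => z _; rewrite lee_fin exprn_ge0.
  - by rewrite leey andbT lee_fin !mulr_ge0 ?exprn_ge0// ltW.
  - apply: le_trans I4 _; rewrite lee_fin le_eqVlt; apply/orP; left; apply/eqP; ring.
rewrite poweR_EFin lee_fin powRM ?mulr_ge0 ?exprn_ge0 ?(ltW D0)//.
rewrite (powRM _ (exprn_ge0 2 x0) (exprn_ge0 2 h0)).
have sq t : 0 <= t -> (t ^+ 2) `^ 4^-1 = t `^ 2^-1 :> R.
  move=> t0; rewrite -(powR_mulrn 2 t0) -powRrM; congr (_ `^ _); by field.
by rewrite !sq// mulrA.
Qed.

End main_estimate.

Unset Implicit Arguments.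
Set Strict Implicit.
Set Printing Implicit Defensive.

Theorem lemma2p15 (R : realType) (R0 theta0 delta : R) (hR0 : 0 < R0)
    (htheta0 : 0 < theta0) (hdelta : 2^-1 <= delta <= 1) :
  exists delta' : R, forall q : R, q = 1 + delta' ->
  exists C : R, 0 < C /\
  forall (eps : R) (u v uw uR uww uwR uRR vw : R * R -> R),
    0 < eps <= 1 ->
    weak_d_omega R0 theta0 (Omega R0 theta0) u uw ->
    weak_d_R R0 theta0 (Omega R0 theta0) u uR ->
    weak_d_omega R0 theta0 (Omega R0 theta0) uw uww ->
    weak_d_R R0 theta0 (Omega R0 theta0) uw uwR ->
    weak_d_R R0 theta0 (Omega R0 theta0) uR uRR ->
    weak_d_omega R0 theta0 (Omega R0 theta0) v vw ->
    (* u_omega + d_R (r v) = 0 *)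
    weak_d_R R0 theta0 (Omega R0 theta0)
      (fun z => rscaled R0 eps z * v z) (fun z => - uw z) ->
    boundary_conditions R0 theta0 eps u v uR vw ->
    (norm_X R0 theta0 eps delta u uw uR < +oo)%E ->
    (norm_H2 R0 theta0 eps delta uww uwR uRR < +oo)%E ->
    (norm_L4 R0 theta0 uw <=
       C%:E * norm_X R0 theta0 eps delta u uw uR `^ 2^-1
            * norm_H2 R0 theta0 eps delta uww uwR uRR `^ 2^-1)%E.
Proof.
(* This constant is chosen before [eps] and the functions, and depends on [R0] and [delta] alone. *)
exists 0 => q _; exists ((4 * R0 `^ (1 - 2 * delta)) `^ 4^-1); split.
  by rewrite powR_gt0// mulr_gt0// powR_gt0.
move=> eps u v uw uR uww uwR uRR vw _ hu huR hww hwR hRR _ hdiv [[_ v0] _ _] nX nH.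
have [ul uwl _] := hu; have [_ uRl _] := huR; have [_ uwwl _] := hww.
have [_ uwRl _] := hwR; have [_ uRRl _] := hRR.
apply: norm_L4_le_of_weak_tensor => // M.
- exact: weak_tensor1_of_divergence_free hww hdiv v0.
- exact: weak_d_R_tensor hwR.
Qed.
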